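(* Let ${\sf C}$ be a strict symmetric monoidal category and let $\mathbb{H}=(H_{1},H_{2})$ be a profinite Hopf brace in ${\sf C}$ (i.e. the underlying object $H$ is profinite). Then the categories ${}_{\mathbb{H}}{\sf Mod}$ (left modules over the Hopf brace $\mathbb{H}$), ${}_{H_{1}\sharp H_{2}}{\sf Mod}$ (left modules over the smash product algebra $H_1\sharp H_2$) and ${}_{H_1}{\sf M}^{H_{2}^{\ast}}$ (left-right $(H_1,H_2^{\ast})$-Doi-Hopf modules) are isomorphic.
   Context: ${\sf C}$ is a strict symmetric monoidal category with tensor product $\otimes$, unit object $K$ and symmetry $c$. For an object $P$ and a morphism $f$, write $P\otimes f$ for ${\rm id}_P\otimes f$ and $f\otimes P$ for $f\otimes {\rm id}_P$. Algebras, coalgebras, Hopf algebras, modules over algebras and comodules over coalgebras in ${\sf C}$ are defined in the usual way; a Hopf algebra is written $(H,\eta_H,\mu_H,\varepsilon_H,\delta_H,\lambda_H)$ (unit, product, counit, coproduct, antipode). For an algebra $A$, ${}_{A}{\sf Mod}$ is the category of left $A$-modules in ${\sf C}$ with $A$-linear morphisms. Hopf brace: a pair $\mathbb{H}=(H_1,H_2)$ of Hopf algebras $H_i=(H,\eta_H^i,\mu_H^i,\varepsilon_H,\delta_H,\lambda_H^i)$, $i=1,2$, in ${\sf C}$ with the same underlying coalgebra $(H,\varepsilon_H,\delta_H)$ (the two algebra structures are allowed to coincide) such that $$\mu_{H}^{2}\circ(H\otimes\mu_{H}^{1})=\mu_{H}^{1}\circ(\mu_{H}^{2}\otimes\Gamma_{H_{1}})\circ(H\otimes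 c_{H,H}\otimes H)\circ(\delta_{H}\otimes H\otimes H),$$ where $\Gamma_{H_{1}}= \mu_{H}^{1}\circ(\lambda_{H}^{1}\otimes\mu_{H}^{2})\circ(\delta_{H}\otimes H)$. It is known that then $\eta_H^1=\eta_H^2$, denoted $\eta_H$. Left $\mathbb{H}$-module: a triple $(M,\varphi_{M}^{1},\varphi_{M}^{2})$ where $(M,\varphi_{M}^{1})$ is a left $H_{1}$-module, $(M,\varphi_{M}^{2})$ is a left $H_{2}$-module and $$\varphi_{M}^{2}\circ(H\otimes\varphi_{M}^{1})=\varphi_{M}^{1}\circ(\mu_{H}^{2}\otimes\Gamma_{M})\circ(H\otimes c_{H,H}\otimes M)\circ(\delta_{H}\otimes H\otimes M),$$ with $\Gamma_{M}=\varphi_{M}^{1}\circ(\lambda_{H}^{1}\otimes\varphi_{M}^{2})\circ(\delta_{H}\otimes M)$. Morphisms are morphisms in ${\sf C}$ that are both $H_1$-linear and $H_2$-linear; the category is ${}_{\mathbb{H}}{\sf Mod}$. Smash product: put $\Gamma'_{H_{1}}= \mu_{H}^{1}\circ(\mu_{H}^{2}\otimes\lambda_{H}^{1})\circ(H\otimes c_{H,H})\circ(\delta_{H}\otimes H)$. It is known that $(H_1,\Gamma'_{H_1})$ is a left $H_2$-module algebra. $H_1\sharp H_2$ is the algebra with underlying object $H\otimes H$, unit $\eta_H\otimes\eta_H$ and product $(\mu_{H}^{1}\otimes\mu_{H}^{2})\circ(H\otimes \Psi\otimes H)$, where $\Psi=(\Gamma'_{H_{1}}\otimes H)\circ(H\otimes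 c_{H,H})\circ(\delta_{H}\otimes H)$. Profinite: an object $P$ is profinite if it has a dual $P^\ast$, i.e. there is a ${\sf C}$-adjunction $-\otimes P\dashv -\otimes P^{\ast}$; equivalently there are morphisms $a_P(K)\colon K\to P\otimes P^\ast$ and $b_P(K)\colon P^\ast\otimes P\to K$ with $(P\otimes b_P(K))\circ(a_P(K)\otimes P)={\rm id}_P$ and $(b_P(K)\otimes P^\ast)\circ(P^\ast\otimes a_P(K))={\rm id}_{P^\ast}$. If a Hopf algebra $H$ is profinite, $H^\ast$ is a Hopf algebra with $\eta_{H^{\ast}}=(\varepsilon_{H}\otimes H^{\ast})\circ a_{H}(K)$, $\varepsilon_{H^{\ast}}=b_{H}(K)\circ (H^{\ast}\otimes \eta_{H})$, $$\mu_{H^{\ast}}=((b_{H}(K)\circ (H^{\ast}\otimes b_{H}(K) \otimes H)) \otimes H^{\ast})\circ (H^{\ast}\otimes H^{\ast}\otimes (((c_{H,H}\circ \delta_{H})\otimes H^{\ast})\circ a_{H}(K))),$$ $$\delta_{H^{\ast}}=((b_{H}(K)\circ (H^{\ast}\otimes (\mu_{H}\circ c_{H,H})))\otimes H^{\ast}\otimes H^{\ast})\circ (H^{\ast}\otimes ((H\otimes a_{H}(K)\otimes H^{\ast})\circ a_{H}(K))),$$ $$\lambda_{H^{\ast}}=((b_{H}(K)\circ (H^{\ast}\otimes\lambda_{H} ))\otimes H^{\ast})\circ (H^{\ast}\otimes a_{H}(K)).$$ $H_2^\ast$ denotes this dual of the Hopf algebra $H_2$. Doi-Hopf modules: for a Hopf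 algebra $L$ and a right $L$-comodule algebra $(A,\rho_A)$ (i.e. $A$ is an algebra and a right $L$-comodule such that $\rho_A\colon A\to A\otimes L$ is an algebra morphism), the category ${}_{A}{\sf M}^{L}$ has as objects triples $(M,\varphi_M,\rho_M)$ with $(M,\varphi_M)$ a left $A$-module, $(M,\rho_M)$ a right $L$-comodule and $\rho_{M}\circ \varphi_{M}=(\varphi_{M}\otimes \mu_{L})\circ (A\otimes c_{L,M}\otimes L)\circ (\rho_{A}\otimes \rho_{M})$; morphisms are left $A$-linear and right $L$-colinear morphisms. In ${}_{H_1}{\sf M}^{H_{2}^{\ast}}$, the algebra $H_1$ is regarded as a right $H_2^\ast$-comodule algebra via $\widehat{\rho}=(\Gamma'_{H_1}\otimes H^{\ast})\circ (H\otimes c_{H^{\ast},H})\circ (a_{H}(K)\otimes H)$. *)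

(* Defs.v *)
From Stdlib Require Import ProofIrrelevance.
From mathcomp Require Import ssreflect ssrfun ssrbool.
Set Implicit Arguments.
Unset Strict Implicit.
Unset Printing Implicit Defensive.

Declare Scope obj_scope.
Delimit Scope obj_scope with obj.
Declare Scope hom_scope.
Delimit Scope hom_scope with hom.

Record category : Type := Category {
  obj :> Type;
  hom : obj -> obj -> Type;
  idm : forall A, hom A A;
  comp : forall A B D, hom B D -> hom A B -> hom A D;
  comp1m : forall A B (f : hom A B), comp (idm B) f = f;
  compm1 : forall A B (f : hom A B), comp f (idm A) = f;
  compA : forall A B D E (h : hom D E) (g : hom B D) (f : hom A B),
    comp h (comp g f) = comp (comp h g) f }.
Arguments idm {c} A%_obj.
Arguments hom {c} (A B)%_obj.
Arguments comp {c A B D} (g f)%_hom.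
Bind Scope obj_scope with obj.
Bind Scope hom_scope with hom.
Open Scope obj_scope.
Open Scope hom_scope.

(* Equality of two morphisms whose sources (resp. targets) are equal objects,
   but not necessarily convertible ones. *)
Inductive heq (C : category) (A B : C) (f : hom A B) :
  forall A' B' : C, hom A' B' -> Prop := heq_refl : heq f f.
Notation "f ≡ g" := (heq f g) (at level 70, no associativity) : type_scope.

Record functor (C D : category) : Type := Functor {
  fobj :> C -> D;
  fmap : forall A B : C, hom A B -> hom (fobj A) (fobj B);
  fmap1 : forall A : C, fmap (idm A) = idm (fobj A);
  fmapM : forall (A B E : C) (g : hom B E) (f : hom A B),
    fmap (comp g f) = comp (fmap g) (fmap f) }.
Arguments fmap {C D} F {A B} f : rename.

Definition is_inverse_functor (C D : category)
    (F : functor C D) (G : functor D C) : Prop :=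
  (forall A : C, G (F A) = A) /\
  (forall (A B : C) (f : hom A B), fmap G (fmap F f) ≡ f).

Definition isomorphic (C D : category) : Prop :=
  exists (F : functor C D) (G : functor D C),
    is_inverse_functor F G /\ is_inverse_functor G F.

Record strict_monoidal : Type := StrictMonoidal {
  mcat :> category;
  unito : mcat;
  tens : mcat -> mcat -> mcat;
  tensA : forall A B D, tens A (tens B D) = tens (tens A B) D;
  tens1o : forall A, tens unito A = A;
  tenso1 : forall A, tens A unito = A;
  tensh : forall A B A' B' : mcat,
    hom A B -> hom A' B' -> hom (tens A A') (tens B B');
  tensh1 : forall A B, tensh (idm A) (idm B) = idm (tens A B);
  tenshM : forall (A B D A' B' D' : mcat) (g : hom B D) (f : hom A B)
      (g' : hom B' D') (f' : hom A' B'),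
    tensh (comp g f) (comp g' f') = comp (tensh g g') (tensh f f');
  tenshA : forall (A B A' B' A'' B'' : mcat)
      (f : hom A B) (f' : hom A' B') (f'' : hom A'' B''),
    tensh f (tensh f' f'') ≡ tensh (tensh f f') f'';
  tensh1m : forall (A B : mcat) (f : hom A B), tensh (idm unito) f ≡ f;
  tenshm1 : forall (A B : mcat) (f : hom A B), tensh f (idm unito) ≡ f }.
Arguments unito {s}.
Arguments tens {s} (A B)%_obj.
Arguments tensh {s A B A' B'} (f g)%_hom.
Notation "A ⊗ B" := (tens A B) (at level 40, left associativity) : obj_scope.
Notation "f ⊗ g" := (tensh f g) (at level 40, left associativity) : hom_scope.

(* Formulas such as μ ∘ (μ ⊗ A) = μ ∘ (A ⊗ μ) are well typed only up to the
   equalities tensA, tens1o and tenso1.  The composition g ∘ f below inserts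
   the identity morphism between the target of f and the source of g; their
   equality is found by instance resolution. *)
Class oeq (C : category) (A B : C) : Prop := oeqE : A = B.
Ltac strict_tac :=
  unfold oeq; first [reflexivity | rewrite ?tensA ?tens1o ?tenso1; reflexivity].
#[export] Hint Extern 0 (oeq _ _) => strict_tac : typeclass_instances.

Definition idto (C : category) (A B : C) (e : A = B) : hom A B :=
  match e in _ = B' return hom A B' with eq_refl => idm A end.

Definition scomp (C : category) (A B B' D : C) (g : hom B' D) (f : hom A B)
  {e : oeq B B'} : hom A D := comp g (comp (idto e) f).
Arguments scomp {C A B B' D} (g f)%_hom {e}.
Notation "g ∘ f" := (scomp g f) (at level 50, left associativity) : hom_scope.

(* f, with source and target replaced by equal objects *)
Definition retype (C : category) (A B A' B' : C) (f : hom A B)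
  {eA : oeq A' A} {eB : oeq B B'} : hom A' B' :=
  comp (idto eB) (comp f (idto eA)).
Arguments retype {C A B A' B'} f%_hom {eA eB}.

Record strict_symmetric : Type := StrictSymmetric {
  smcat :> strict_monoidal;
  sym : forall A B : smcat, hom (A ⊗ B) (B ⊗ A);
  sym_nat : forall (A B A' B' : smcat) (f : hom A B) (f' : hom A' B'),
    sym B B' ∘ (f ⊗ f') = (f' ⊗ f) ∘ sym A A';
  symK : forall A B, sym B A ∘ sym A B = idm (A ⊗ B);
  sym_hexagon : forall A B D,
    sym A (B ⊗ D) ≡ (idm B ⊗ sym A D) ∘ (sym A B ⊗ idm D) }.
Arguments sym {s} (A B)%_obj.

Section Structures.
Variable C : strict_symmetric.
Notation K := (@unito C).

Record alg (A : C) : Type := Alg { aunit : hom K A; amul : hom (A ⊗ A) A }.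

Record is_alg (A : C) (S : alg A) : Prop := IsAlg {
  alg_unitl : amul S ∘ (aunit S ⊗ idm A) ≡ idm A;
  alg_unitr : amul S ∘ (idm A ⊗ aunit S) ≡ idm A;
  alg_assoc : amul S ∘ (amul S ⊗ idm A) ≡ amul S ∘ (idm A ⊗ amul S) }.

Record coalg (H : C) : Type :=
  Coalg { counit : hom H K; comul : hom H (H ⊗ H) }.

Record is_coalg (H : C) (T : coalg H) : Prop := IsCoalg {
  coalg_counitl : (counit T ⊗ idm H) ∘ comul T ≡ idm H;
  coalg_counitr : (idm H ⊗ counit T) ∘ comul T ≡ idm H;
  coalg_coassoc :
    (comul T ⊗ idm H) ∘ comul T ≡ (idm H ⊗ comul T) ∘ comul T }.

Record is_hopf (H : C) (S : alg H) (T : coalg H) (lam : hom H H) : Prop :=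
 IsHopf {
  hopf_alg : is_alg S;
  hopf_coalg : is_coalg T;
  hopf_counit_unit : counit T ∘ aunit S = idm K;
  hopf_counit_mul : counit T ∘ amul S ≡ counit T ⊗ counit T;
  hopf_comul_unit : comul T ∘ aunit S ≡ aunit S ⊗ aunit S;
  hopf_comul_mul : comul T ∘ amul S =
    (amul S ⊗ amul S) ∘ (idm H ⊗ sym H H ⊗ idm H) ∘ (comul T ⊗ comul T);
  hopf_antipodel : amul S ∘ (lam ⊗ idm H) ∘ comul T = aunit S ∘ counit T;
  hopf_antipoder : amul S ∘ (idm H ⊗ lam) ∘ comul T = aunit S ∘ counit T }.

Record hopf_brace : Type := HopfBrace {
  hb :> C;
  hb_coalg : coalg hb;
  hb_alg1 : alg hb;
  hb_anti1 : hom hb hb;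
  hb_alg2 : alg hb;
  hb_anti2 : hom hb hb;
  hb_hopf1 : is_hopf hb_alg1 hb_coalg hb_anti1;
  hb_hopf2 : is_hopf hb_alg2 hb_coalg hb_anti2;
  hb_compat :
    let H := hb in
    let mu1 := amul hb_alg1 in
    let mu2 := amul hb_alg2 in
    let delta := comul hb_coalg in
    let Gamma := mu1 ∘ (hb_anti1 ⊗ mu2) ∘ (delta ⊗ idm H) in
    mu2 ∘ (idm H ⊗ mu1) ≡
    mu1 ∘ (mu2 ⊗ Gamma) ∘ (idm H ⊗ sym H H ⊗ idm H)
        ∘ (delta ⊗ idm H ⊗ idm H) }.

(* The objects are those of C with extra structure, and the morphisms are the
   morphisms of C satisfying P. *)
Section StructuredCategory.
Variables (T : Type) (U : T -> C).
Variable P : forall X Y : T, hom (U X) (U Y) -> Prop.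
Hypothesis P1 : forall X, P (idm (U X)).
Hypothesis PM : forall X Y Z (g : hom (U Y) (U Z)) (f : hom (U X) (U Y)),
  P g -> P f -> P (comp g f).

Definition struct_hom (X Y : T) : Type := {f : hom (U X) (U Y) | P f}.

Definition struct_idm (X : T) : struct_hom X X := exist _ (idm (U X)) (P1 X).

Definition struct_comp (X Y Z : T) (g : struct_hom Y Z) (f : struct_hom X Y) : struct_hom X Z :=
  exist _ (comp (proj1_sig g) (proj1_sig f))
    (PM (proj2_sig g) (proj2_sig f)).

Lemma struct_hom_eq (X Y : T) (f g : struct_hom X Y) : proj1_sig f = proj1_sig g -> f = g.
Proof. by case: f g => [f Pf] [g Pg]; apply: subset_eq_compat. Qed.

Lemma struct_comp1m X Y (f : struct_hom X Y) :
  struct_comp (struct_idm Y) f = f.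
Proof. exact/struct_hom_eq/comp1m. Qed.

Lemma struct_compm1 X Y (f : struct_hom X Y) :
  struct_comp f (struct_idm X) = f.
Proof. exact/struct_hom_eq/compm1. Qed.

Lemma struct_compA X Y Z W (h : struct_hom Z W) (g : struct_hom Y Z)
    (f : struct_hom X Y) :
  struct_comp h (struct_comp g f) = struct_comp (struct_comp h g) f.
Proof. exact/struct_hom_eq/compA. Qed.

Definition structured_category : category :=
  Category struct_comp1m struct_compm1 struct_compA.

End StructuredCategory.

Section Linear.
Variables (A : C) (M N : C).

Definition linear (phiM : hom (A ⊗ M) M) (phiN : hom (A ⊗ N) N)
  (f : hom M N) : Prop := f ∘ phiM = phiN ∘ (idm A ⊗ f).

Definition colinear (rhoM : hom M (M ⊗ A)) (rhoN : hom N (N ⊗ A))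
  (f : hom M N) : Prop := rhoN ∘ f = (f ⊗ idm A) ∘ rhoM.

End Linear.

Lemma scompE (A B D : C) (g : hom B D) (f : hom A B) (e : oeq B B) :
  scomp g f (e := e) = comp g f.
Proof. by rewrite /scomp (proof_irrelevance _ e eq_refl) /= comp1m. Qed.

Lemma linear1 (A M : C) (phi : hom (A ⊗ M) M) : linear phi phi (idm M).
Proof. by rewrite /linear !scompE tensh1 comp1m compm1. Qed.

Lemma linearM (A M N P : C) (phiM : hom (A ⊗ M) M) (phiN : hom (A ⊗ N) N)
    (phiP : hom (A ⊗ P) P) (g : hom N P) (f : hom M N) :
  linear phiN phiP g -> linear phiM phiN f -> linear phiM phiP (comp g f).
Proof.
rewrite /linear !scompE => lg lf.
by rewrite -(comp1m (idm A)) tenshM compA -lg -!compA lf.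
Qed.

Lemma colinear1 (A M : C) (rho : hom M (M ⊗ A)) : colinear rho rho (idm M).
Proof. by rewrite /colinear !scompE tensh1 comp1m compm1. Qed.

Lemma colinearM (A M N P : C) (rhoM : hom M (M ⊗ A)) (rhoN : hom N (N ⊗ A))
    (rhoP : hom P (P ⊗ A)) (g : hom N P) (f : hom M N) :
  colinear rhoN rhoP g -> colinear rhoM rhoN f ->
  colinear rhoM rhoP (comp g f).
Proof.
rewrite /colinear !scompE => lg lf.
by rewrite -(comp1m (idm A)) tenshM compA lg -!compA lf.
Qed.

Record is_lmod (A : C) (S : alg A) (M : C) (phi : hom (A ⊗ M) M) : Prop :=
 IsLmod {
  lmod_unit : phi ∘ (aunit S ⊗ idm M) ≡ idm M;
  lmod_assoc : phi ∘ (idm A ⊗ phi) ≡ phi ∘ (amul S ⊗ idm M) }.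

Record is_rcomod (L : C) (T : coalg L) (M : C) (rho : hom M (M ⊗ L)) : Prop :=
 IsRcomod {
  rcomod_counit : (idm M ⊗ counit T) ∘ rho ≡ idm M;
  rcomod_coassoc : (rho ⊗ idm L) ∘ rho ≡ (idm M ⊗ comul T) ∘ rho }.

(* The category of modules over an algebra depends only on its unit and
   product, so it is defined on these data without requiring is_alg; likewise
   Doi-Hopf modules only use the unit, product, counit and coproduct of L and
   the coaction of A. *)
Record lmodule (A : C) (S : alg A) : Type := Lmodule {
  lmod_obj :> C;
  lmod_act : hom (A ⊗ lmod_obj) lmod_obj;
  lmod_ax : is_lmod S lmod_act }.

Definition lMod (A : C) (S : alg A) : category :=
  @structured_category (lmodule S) (@lmod_obj A S)
    (fun M N f => linear (lmod_act M) (lmod_act N) f)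
    (fun M => linear1 (lmod_act M))
    (fun M N P g f lg lf => linearM lg lf).

Record hb_module (H : hopf_brace) : Type := HbModule {
  hbm_obj :> C;
  hbm_act1 : hom (H ⊗ hbm_obj) hbm_obj;
  hbm_act2 : hom (H ⊗ hbm_obj) hbm_obj;
  hbm_lmod1 : is_lmod (hb_alg1 H) hbm_act1;
  hbm_lmod2 : is_lmod (hb_alg2 H) hbm_act2;
  hbm_compat :
    let M := hbm_obj in
    let mu2 := amul (hb_alg2 H) in
    let delta := comul (hb_coalg H) in
    let Gamma := hbm_act1 ∘ (hb_anti1 H ⊗ hbm_act2) ∘ (delta ⊗ idm M) in
    hbm_act2 ∘ (idm (H : C) ⊗ hbm_act1) ≡
    hbm_act1 ∘ (mu2 ⊗ Gamma) ∘ (idm (H : C) ⊗ sym H H ⊗ idm M)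
             ∘ (delta ⊗ idm (H : C) ⊗ idm M) }.

Definition hbMod (H : hopf_brace) : category :=
  @structured_category (hb_module H) (@hbm_obj H)
    (fun M N f => linear (hbm_act1 M) (hbm_act1 N) f /\
                  linear (hbm_act2 M) (hbm_act2 N) f)
    (fun M => conj (linear1 (hbm_act1 M)) (linear1 (hbm_act2 M)))
    (fun M N P g f lg lf =>
       conj (linearM (proj1 lg) (proj1 lf)) (linearM (proj2 lg) (proj2 lf))).

(* The left action of H_2 on H_1, h . a = (h_1 *_2 a) *_1 lambda_1(h_2). *)
Definition hb_Gamma' (H : hopf_brace) : hom (H ⊗ H) H :=
  amul (hb_alg1 H) ∘ (amul (hb_alg2 H) ⊗ hb_anti1 H)
    ∘ (idm (H : C) ⊗ sym H H) ∘ (comul (hb_coalg H) ⊗ idm (H : C)).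

Definition smash_twist (H : hopf_brace) : hom (H ⊗ H) (H ⊗ H) :=
  (hb_Gamma' H ⊗ idm (H : C)) ∘ (idm (H : C) ⊗ sym H H)
    ∘ (comul (hb_coalg H) ⊗ idm (H : C)).

(* The product is (a # h)(b # g) = a *_1 (h_1 . b) # h_2 *_2 g. *)
Definition smash (H : hopf_brace) : alg (H ⊗ H) :=
  {| aunit := retype (aunit (hb_alg1 H) ⊗ aunit (hb_alg2 H));
     amul := retype ((amul (hb_alg1 H) ⊗ amul (hb_alg2 H))
               ∘ (idm (H : C) ⊗ smash_twist H ⊗ idm (H : C))) |}.

(* The unit and counit, at the object K, of an adjunction - ⊗ P ⊣ - ⊗ P^*. *)
Record dual (P : C) : Type := Dual {
  dual_obj : C;
  coev : hom K (P ⊗ dual_obj);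
  ev : hom (dual_obj ⊗ P) K;
  dual_triangle1 : (idm P ⊗ ev) ∘ (coev ⊗ idm P) ≡ idm P;
  dual_triangle2 :
    (ev ⊗ idm dual_obj) ∘ (idm dual_obj ⊗ coev) ≡ idm dual_obj }.

Section DualHopf.
Variables (H : C) (S : alg H) (T : coalg H) (D : dual H).
Notation Hd := (dual_obj D).
Notation a := (coev D).
Notation b := (ev D).

Definition dual_alg : alg Hd :=
  {| aunit := retype ((counit T ⊗ idm Hd) ∘ a);
     amul := retype
       (((b ∘ (idm Hd ⊗ b ⊗ idm H)) ⊗ idm Hd)
        ∘ (idm Hd ⊗ idm Hd ⊗ (((sym H H ∘ comul T) ⊗ idm Hd) ∘ a))) |}.

Definition dual_coalg : coalg Hd :=
  {| counit := retype (b ∘ (idm Hd ⊗ aunit S));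
     comul := retype
       (((b ∘ (idm Hd ⊗ (amul S ∘ sym H H))) ⊗ idm Hd ⊗ idm Hd)
        ∘ (idm Hd ⊗ ((idm H ⊗ a ⊗ idm Hd) ∘ a))) |}.

End DualHopf.

Section DoiHopf.
Variables (A L : C) (S : alg A) (SL : alg L) (TL : coalg L).
Variable rhoA : hom A (A ⊗ L).

Record doi_hopf_module : Type := DoiHopfModule {
  dh_obj :> C;
  dh_act : hom (A ⊗ dh_obj) dh_obj;
  dh_coact : hom dh_obj (dh_obj ⊗ L);
  dh_lmod : is_lmod S dh_act;
  dh_rcomod : is_rcomod TL dh_coact;
  dh_compat :
    dh_coact ∘ dh_act =
    (dh_act ⊗ amul SL) ∘ (idm A ⊗ sym L dh_obj ⊗ idm L)
      ∘ (rhoA ⊗ dh_coact) }.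

Definition DoiHopfMod : category :=
  @structured_category doi_hopf_module dh_obj
    (fun M N f => linear (dh_act M) (dh_act N) f /\
                  colinear (dh_coact M) (dh_coact N) f)
    (fun M => conj (linear1 (dh_act M)) (colinear1 (dh_coact M)))
    (fun M N P g f lg lf =>
       conj (linearM (proj1 lg) (proj1 lf)) (colinearM (proj2 lg) (proj2 lf))).

End DoiHopf.

Definition hb_coaction (H : hopf_brace) (D : dual H) :
    hom H (H ⊗ dual_obj D) :=
  retype ((hb_Gamma' H ⊗ idm (dual_obj D))
            ∘ (idm (H : C) ⊗ sym (dual_obj D) H) ∘ (coev D ⊗ idm (H : C))).

Definition hbDoiHopfMod (H : hopf_brace) (D : dual H) : category :=
  DoiHopfMod (hb_alg1 H) (dual_alg (hb_coalg H) D)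
    (dual_coalg (hb_alg2 H) D) (hb_coaction D).

End Structures.

Arguments hbMod {C} H.
Arguments smash {C} H.
Arguments lMod {C A} S.
Arguments hbDoiHopfMod {C} H D.

(* Main.v *)
From Stdlib Require Import ProofIrrelevance ClassicalEpsilon.
From mathcomp Require Import all_boot.
Require Import Defs.
Set Implicit Arguments.
Unset Strict Implicit.
Unset Printing Implicit Defensive.

(** A brace module amounts to an H1-action φ1 and an H2-action φ2 such that
    h·(a·m) = Γ'(h₁, a)·(h₂·m).  This is exactly what makes φ1 ∘ (H ⊗ φ2) an
    action of the smash product, whose restrictions along a ↦ a # 1 and
    h ↦ 1 # h recover φ1 and φ2; and transposing φ2 along the duality turns it
    into a coaction of H2^*, under which the same identity becomes the
    Doi-Hopf compatibility.

    The identities between composites are proved by reflection on string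
    diagrams.  A diagram is a list of boxes connected by named wires; the
    symmetries are not recorded, they are recovered from the names.  By the
    coherence theorem for permutations of distinct wires the morphism denoted by
    a diagram depends neither on the order of independent boxes nor on the names
    of inner wires, so that a subdiagram may be replaced by another one with the
    same denotation. *)

(** * Morphisms with bundled source and target *)

(** Strictness makes [A ⊗ (B ⊗ D)] and [(A ⊗ B) ⊗ D] equal but not convertible, so most identities
    are not even well typed without casts. Bundling a morphism with its endpoints removes the casts:
    an identity becomes an equality in the single type [arr], and typing becomes a proposition
    checked separately. The price is a composition defined on all pairs, hence the many side
    conditions on endpoints. Γ' enters the brace condition through associativity of φ1: in μ2(h₁,
    a)·(λ1(h₂)·(h₃·m)) the two outer actions merge into that of μ2(h₁, a) λ1(h₂), which is Γ' of the
    two remaining arguments. The brace carries two a priori distinct units, and the unit η1 ⊗ η2 of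
    the smash product mixes them, so their equality is first derived from the compatibility
    condition. The diagram checker searches without guarantees and validates by computation what it
    finds: freshness of wires is not an invariant to be maintained, it is retested wherever a lemma
    needs it. *)

Section Arrows.
Variable C : strict_symmetric.
Implicit Types (A B D E : C).

Record arr : Type := Arr { asrc : C; atgt : C; amor : hom asrc atgt }.

(** Turns the heterogeneous equality of the definitions into an ordinary one, with which one can
    rewrite. *)
Lemma heq_arr A B A' B' (f : hom A B) (g : hom A' B') :
  f ≡ g <-> Arr f = Arr g.
Proof.
split=> [[] //|fg].
suff h x : x = Arr g -> amor x ≡ g by exact: (h (Arr f)).
by move=> ->.
Qed.

(** The way back from arrows to morphisms. It is uniqueness of identity proofs, used once for each
    endpoint through [inj_pair2]. *)
Lemma arr_inj A B (f g : hom A B) : Arr f = Arr g -> f = g.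
Proof.
move=> e; apply: (inj_pair2 C (hom A) B).
apply: (inj_pair2 C (fun A => {B & hom A B}) A).
pose G x := existT (fun A => {B & hom A B}) (asrc x)
  (existT (fun B => hom (asrc x) B) (atgt x) (amor x)).
by rewrite -[LHS]/(G (Arr f)) e.
Qed.

Definition aid A := Arr (idm A).

(* Junk value [f] when [g] and [f] are not composable. *)
Definition acomp (g f : arr) : arr :=
  if excluded_middle_informative (atgt f = asrc g) is left e
  then Arr (comp (amor g) (comp (idto e) (amor f))) else f.

Definition atens (f g : arr) : arr := Arr (amor f ⊗ amor g).

Definition asym A B := Arr (sym A B).

Notation "g * f" := (acomp g f).
Notation "f @ g" := (atens f g) (at level 39, left associativity).

Lemma ArrM A B D (g : hom B D) (f : hom A B) : Arr (comp g f) = Arr g * Arr f.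
Proof.
rewrite /acomp; case: excluded_middle_informative => //= e.
by rewrite (proof_irrelevance _ e erefl) /= comp1m.
Qed.

Lemma Arr_scomp A B B' D (g : hom B' D) (f : hom A B) (e : oeq B B') :
  Arr (scomp g f (e := e)) = Arr g * Arr f.
Proof. by rewrite -/B in e *; move: g; case: _ / e => g; rewrite scompE ArrM. Qed.

Lemma Arr_retype A B A' B' (f : hom A B) (eA : oeq A' A) (eB : oeq B B') :
  Arr (retype f (eA := eA) (eB := eB)) = Arr f.
Proof.
rewrite /retype; unfold oeq in *.
by move: f; case: _ / eA; case: _ / eB => f /=; rewrite comp1m compm1.
Qed.

Lemma Arr_tensh A B A' B' (f : hom A B) (g : hom A' B') :
  Arr (f ⊗ g) = Arr f @ Arr g.
Proof. by []. Qed.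

(** Endpoints are known only up to the strictness equations; [typecheck] discharges the resulting
    equalities of objects. *)
Definition ty (f : arr) A B := asrc f = A /\ atgt f = B.

Lemma tyP f A B : ty f A B -> exists h : hom A B, f = Arr h.
Proof. by case: f => ? ? h [/= <- <-]; exists h. Qed.

Lemma ty_id A : ty (aid A) A A. Proof. by []. Qed.

Lemma ty_sym A B : ty (asym A B) (A ⊗ B) (B ⊗ A). Proof. by []. Qed.

Lemma ty_comp f g A B B' D :
  ty f A B -> ty g B' D -> B = B' -> ty (g * f) A D.
Proof. by move=> /tyP[h ->] /tyP[k ->] e; subst B'; rewrite -ArrM. Qed.

Lemma ty_tens f g A B A' B' :
  ty f A B -> ty g A' B' -> ty (f @ g) (A ⊗ A') (B ⊗ B').
Proof. by move=> /tyP[h ->] /tyP[k ->]. Qed.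

Lemma acompA f g h : atgt f = asrc g -> atgt g = asrc h ->
  h * (g * f) = (h * g) * f.
Proof.
case: f g h => [A B f] [B' D g] [D' E h] /= e1 e2; subst B' D'.
by rewrite -!ArrM compA.
Qed.

Lemma acomp1m f A : atgt f = A -> aid A * f = f.
Proof. by case: f => [B A' f] /= e; subst A'; rewrite -ArrM comp1m. Qed.

Lemma acompm1 f A : asrc f = A -> f * aid A = f.
Proof. by case: f => [A' B f] /= e; subst A'; rewrite -ArrM compm1. Qed.

Lemma atensA f g h : f @ (g @ h) = f @ g @ h.
Proof. by case: f g h => ? ? f [? ? g] [? ? h]; exact/heq_arr/tenshA. Qed.

Lemma atens1m f : aid unito @ f = f.
Proof. by case: f => ? ? f; exact/heq_arr/tensh1m. Qed.

Lemma atensm1 f : f @ aid unito = f.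
Proof. by case: f => ? ? f; exact/heq_arr/tenshm1. Qed.

Lemma atens_id A B : aid A @ aid B = aid (A ⊗ B).
Proof. by rewrite /aid /atens /= tensh1. Qed.

Lemma atensM f g f' g' : atgt f = asrc g -> atgt f' = asrc g' ->
  (g * f) @ (g' * f') = (g @ g') * (f @ f').
Proof.
case: f g f' g' => [? B f] [B1 ? g] [? B' f'] [B1' ? g'] /= e e'.
by subst B1 B1'; rewrite -!ArrM /atens /= tenshM ArrM.
Qed.

Lemma asym_nat f f' :
  asym (atgt f) (atgt f') * (f @ f') = (f' @ f) * asym (asrc f) (asrc f').
Proof.
by case: f f' => [? ? f] [? ? f'] /=; rewrite -!Arr_scomp sym_nat.
Qed.

Lemma asymK A B : asym B A * asym A B = aid (A ⊗ B).
Proof. by rewrite /asym -Arr_scomp symK. Qed.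

Lemma asym_hex A B D :
  asym A (B ⊗ D) = (aid B @ asym A D) * (asym A B @ aid D).
Proof. by rewrite [LHS](proj1 (heq_arr _ _) (sym_hexagon A B D)) Arr_scomp. Qed.

(** The hexagon at (A, K, K) makes this symmetry idempotent, and it is invertible by [asymK]; an
    invertible idempotent is an identity. *)
Lemma asymo1 A : asym A unito = aid A.
Proof.
have t : ty (asym A unito) A A by split; rewrite /= ?tenso1 ?tens1o.
have t' : ty (asym unito A) A A by split; rewrite /= ?tenso1 ?tens1o.
have e : asym A unito * asym A unito = asym A unito.
  have := asym_hex A unito unito; rewrite atens1m atensm1 => <-.
  by rewrite tenso1.
have e' := asymK A unito; rewrite tenso1 in e'.
rewrite -{1}[asym A unito](acomp1m (A := A)) ?(proj2 t) // -e' -acompA.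
- by rewrite e.
- by rewrite (proj1 t) (proj2 t).
by rewrite (proj1 t') (proj2 t).
Qed.

End Arrows.

Declare Scope arr_scope.
Delimit Scope arr_scope with arr.
Notation "g * f" := (acomp g f) : arr_scope.
Notation "f @ g" := (atens f g) (at level 39, left associativity) : arr_scope.

(** * Permutations of wires *)

(* (colour, index); the colour determines the object carried by the wire *)
Notation wire := (nat * nat)%type.
Implicit Types (x y z : wire) (r s t u : seq wire).

Definition del x s := [seq y <- s | y != x].
Arguments del : simpl never.

Lemma delC x y s : del x (del y s) = del y (del x s).
Proof. by rewrite /del -!filter_predI; apply: eq_filter => z /=; rewrite andbC. Qed.

Lemma del_notin x s : x \notin s -> del x s = s.
Proof. by move=> xs; apply/all_filterP/allP => y ys; apply: contraNneq xs => <-. Qed.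

Lemma del_cat x s t : del x (s ++ t) = del x s ++ del x t.
Proof. exact: filter_cat. Qed.

Lemma del_uniq x s : uniq s -> uniq (del x s).
Proof. exact: filter_uniq. Qed.

Lemma mem_del x y s : (y \in del x s) = (y != x) && (y \in s).
Proof. exact: mem_filter. Qed.

Lemma perm_del x s t : perm_eq s t -> perm_eq (del x s) (del x t).
Proof. exact: perm_filter. Qed.

Lemma del_cons x s : x \notin s -> del x (x :: s) = s.
Proof. by move=> xs; rewrite -{2}(del_notin xs) /del /= eqxx. Qed.

Lemma perm_consr x s t : uniq s -> perm_eq s (x :: t) ->
  [/\ x \in s, uniq (del x s) & perm_eq (del x s) t].
Proof.
move=> us st; have ut : uniq (x :: t) by rewrite -(perm_uniq st).
split; [by rewrite (perm_mem st) mem_head | exact: del_uniq |].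
by move: ut (perm_del x st) => /andP[xt _]; rewrite del_cons.
Qed.

Lemma uniq_mid s x t : uniq (s ++ x :: t) -> x \notin s /\ x \notin t.
Proof.
by rewrite cat_uniq => /and3P[_ /hasPn/(_ x (mem_head _ _)) xs /andP[xt _]].
Qed.

Lemma uniq_catl s t : uniq (s ++ t) -> uniq s.
Proof. by rewrite cat_uniq => /andP[]. Qed.

Lemma uniq_catr s t : uniq (s ++ t) -> uniq t.
Proof. by rewrite cat_uniq => /and3P[]. Qed.

Lemma notin_catr x s t : uniq (s ++ t) -> x \in s -> x \notin t.
Proof.
by rewrite cat_uniq => /and3P[_ /hasPn st _] xs; apply/negP => /st /negP.
Qed.

Section Objects.
Variables (C : strict_symmetric) (ob : nat -> C).
Local Notation "! x" := (ob x.1) (at level 5, format "! x").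

Definition cfold (c : seq nat) : C := foldr (fun i A => ob i ⊗ A)%obj unito c.

Definition ifold s : C := foldr (fun x A => !x ⊗ A)%obj unito s.
Local Notation I := ifold.

Lemma ifold_cat s t : I (s ++ t) = (I s ⊗ I t)%obj.
Proof. by elim: s => [|x s IH] /=; rewrite ?tens1o // IH tensA. Qed.

Lemma ifoldE s : I s = cfold [seq x.1 | x <- s].
Proof. by elim: s => //= x s ->. Qed.

End Objects.

Lemma ty_eq (C : strict_symmetric) (f g : arr C) A B B' D :
  ty f A B -> ty g B' D -> B = B' -> atgt f = asrc g.
Proof. by move=> [_ ->] [-> _]. Qed.

Lemma ty_tgt (C : strict_symmetric) (f : arr C) A B : ty f A B -> atgt f = B.
Proof. by case. Qed.

Lemma ty_src (C : strict_symmetric) (f : arr C) A B : ty f A B -> asrc f = A.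
Proof. by case. Qed.

Lemma ty_cast (C : strict_symmetric) (f : arr C) A B A' B' :
  ty f A B -> A = A' -> B = B' -> ty f A' B'.
Proof. by move=> ? <- <-. Qed.

Ltac obj_eq := rewrite /= ?ifold_cat /= ?tensA ?tens1o ?tenso1 ?tensA; reflexivity.
Ltac infer_type :=
  first [ eassumption | apply: ty_id | apply: ty_sym
        | (eapply ty_tens; [infer_type | infer_type])
        | (eapply ty_comp; [infer_type | infer_type | obj_eq]) ].
Ltac typecheck := first [ (eapply ty_cast; [infer_type | obj_eq | obj_eq])
  | (eapply ty_eq; [infer_type | infer_type | obj_eq])
  | (etransitivity; [eapply ty_tgt; infer_type | obj_eq])
  | (etransitivity; [eapply ty_src; infer_type | obj_eq]) ].

(** * Coherence: composites of symmetries depend only on the permutation of the wires *)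

Section Coherence.
Variables (C : strict_symmetric) (ob : nat -> C).
Local Open Scope arr_scope.
Local Notation "! x" := (ob x.1) (at level 5, format "! x").
Local Notation I := (ifold ob).

(* The symmetry moving the wire [x] of [s] to the front. *)
Fixpoint front x s : arr C :=
  if s is y :: s' then
    if y == x then aid (I s)
    else (asym !y !x @ aid (I (del x s'))) * (aid !y @ front x s')
  else aid unito.

Arguments front : simpl never.

(* The symmetry from [s] to its permutation [t]. *)
Fixpoint shuffle s t : arr C :=
  if t is x :: t' then (aid !x @ shuffle (del x s) t') * front x s
  else aid (I s).

Lemma front_cons x y s : front x (y :: s) = if y == x then aid (I (y :: s))
  else (asym !y !x @ aid (I (del x s))) * (aid !y @ front x s).
Proof. by []. Qed.

Lemma del_consE x y s : del x (y :: s) = if y == x then del x s else y :: del x s.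
Proof. by rewrite /del /=; case: (y == x). Qed.

Lemma ty_front x s : uniq s -> x \in s -> ty (front x s) (I s) (I (x :: del x s)).
Proof.
elim: s => // y s IH /andP[ys us]; rewrite inE front_cons del_consE.
have [<-|yx] /= := eqVneq y x; first by rewrite del_notin.
move=> xs; have t := IH us xs; typecheck.
Qed.

Lemma ty_shuffle s t : uniq s -> perm_eq s t -> ty (shuffle s t) (I s) (I t).
Proof.
elim: t s => [|x t IH] s us; first by move/perm_nilP->.
move/(perm_consr us) => [xs ud dt] /=.
have t1 := ty_front us xs; have t2 := IH _ ud dt; typecheck.
Qed.

(** By the hexagon, two of the crossings form the symmetry of z with x ⊗ y; naturality then carries
    the crossing of x and y through it. *)
Lemma yang_baxter x y z :
  (asym !x !y @ aid !z) * ((aid !x @ asym !z !y) * (asym !z !x @ aid !y))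
  = (aid !y @ asym !z !x) * ((asym !z !y @ aid !x) * (aid !z @ asym !x !y)).
Proof.
rewrite -asym_hex.
have := asym_nat (aid !z) (asym !x !y) => /= <-.
by rewrite asym_hex acompA //; typecheck.
Qed.

Lemma atensMl A (f g : arr C) : atgt f = asrc g ->
  aid A @ (g * f) = (aid A @ g) * (aid A @ f).
Proof. by move=> e; rewrite -atensM // acomp1m. Qed.

Lemma atensMr A (f g : arr C) : atgt f = asrc g ->
  (g * f) @ aid A = (g @ aid A) * (f @ aid A).
Proof. by move=> e; rewrite -atensM // acomp1m. Qed.

Lemma slide A B A' B' (f g : arr C) : ty f A B -> ty g A' B' ->
  (aid B @ g) * (f @ aid A') = (f @ aid B') * (aid A @ g).
Proof.
move=> [fA fB] [gA gB]; rewrite -!atensM //= ?fB ?gA //.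
by rewrite !acomp1m // !acompm1.
Qed.

Lemma acomp4 (f g h k : arr C) :
  atgt f = asrc g -> atgt g = asrc h -> atgt h = asrc k ->
  (k * h) * (g * f) = k * ((h * g) * f).
Proof.
case: f g h k => [? B f] [B' D g] [D' E h] [E' ? k] /= e1 e2 e3; subst.
by rewrite -!ArrM !compA.
Qed.

(** Induction on [s]. If the head is x or y, the extra crossing is already present on the other side
    or cancels by [asymK]. Otherwise both extractions cross the head, and the induction hypothesis
    leaves a Yang-Baxter relation. *)
Lemma front_front x y s : uniq s -> x \in s -> y \in s -> x != y ->
  (asym !x !y @ aid (I (del y (del x s)))) *
    ((aid !x @ front y (del x s)) * front x s)
  = (aid !y @ front x (del y s)) * front y s.
Proof.
elim: s => // z s IH /andP[zs us]; rewrite !inE !front_cons !del_consE.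
have [e|zx] := eqVneq z x; first clear IH; first subst x.
  move=> _; have [-> //|yz /= ys _] := eqVneq y z.
  rewrite front_cons eqxx.
  rewrite (del_notin zs).
  have t := ty_front us ys.
  rewrite acompm1; last by typecheck.
  rewrite atens_id acomp1m //; typecheck.
have [e|zy] /= := eqVneq z y; first clear IH; first subst y.
  move=> xs _ _; rewrite front_cons del_consE eqxx (del_notin zs).
  have zd : z \notin del x s by rewrite mem_del (negPf zs) andbF.
  have t := ty_front us xs; rewrite (del_notin zd) atens_id /=.
  rewrite acompm1; last by typecheck.
  rewrite acomp1m; last by typecheck.
  rewrite acompA; [|typecheck|typecheck].
  rewrite -atensM; [|typecheck|typecheck].
  rewrite asymK acomp1m; last by typecheck.
  rewrite atens_id acomp1m //; typecheck.
move=> xs ys xy; rewrite !front_cons !del_consE (negPf zx) (negPf zy) /=.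
have tx := ty_front us xs; have t_y := ty_front us ys.
have xd : x \in del y s by rewrite mem_del xy.
have yd : y \in del x s by rewrite mem_del eq_sym xy.
have txd := ty_front (del_uniq y us) xd.
have tyd := ty_front (del_uniq x us) yd.
have IHs := IH us xs ys xy.
have er := delC x y s; set r := del y (del x s) in er tyd IHs *.
rewrite -/r in txd; rewrite er /= in txd.
rewrite er.
rewrite !atensMl; [|typecheck|typecheck].
rewrite !atensA !atens_id.
have -> : aid (!z ⊗ I r)%obj = aid !z @ aid (I r) by rewrite atens_id.
rewrite !atensA !acomp4; try typecheck.
rewrite (slide (ty_sym !z !x) tyd) (slide (ty_sym !z !y) txd) /= -!atens_id !atensA.
rewrite -[(_ * _) * (_ @ front x s)]acompA; try typecheck.
rewrite -[(_ * _) * (_ @ front y s)]acompA; try typecheck.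
rewrite -![aid !z @ _ @ _]atensA -!atensMl; try typecheck.
rewrite -IHs [aid !z @ (_ * (_ * _))]atensMl; try typecheck.
rewrite !atensA [LHS]acompA; try typecheck.
rewrite [in LHS]acompA; try typecheck.
rewrite [RHS]acompA; try typecheck.
rewrite [RHS]acompA; try typecheck.
congr (_ * _); rewrite -!atensMr; try typecheck.
by rewrite -![(_ * _) * _]acompA ?yang_baxter //; typecheck.
Qed.

(** Lets one wire be extracted before a shuffle instead of after it, which is the inductive step of
    [shuffleM]. When the head y of [t] is not x, [front_front] exchanges the two extractions. *)
Lemma front_shuffle x s t : uniq s -> perm_eq s t -> x \in s ->
  front x t * shuffle s t = (aid !x @ shuffle (del x s) (del x t)) * front x s.
Proof.
elim: t s => [|y t IH] s us; first by move/perm_nilP->.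
move=> st xs; have [ys ud dt] := perm_consr us st.
have ut : uniq (y :: t) by rewrite -(perm_uniq st).
have t1 := ty_front us ys; have t2 := ty_shuffle ud dt.
rewrite front_cons del_consE /=.
have [e|yx] := eqVneq y x.
  subst y; rewrite acomp1m; last by typecheck.
  by rewrite (del_notin (proj1 (andP ut))).
have xd : x \in del y s by rewrite mem_del eq_sym yx.
have yd : y \in del x s by rewrite mem_del yx.
have xt : x \in t by rewrite -(perm_mem dt).
have tx := ty_front us xs.
have tt := ty_front (proj2 (andP ut)) xt.
have txd := ty_front ud xd.
have tyd := ty_front (del_uniq x us) yd.
have tdd := ty_shuffle (del_uniq x ud) (perm_del x dt).
rewrite acomp4; try typecheck.
rewrite -atensMl ?IH //; try typecheck.
rewrite atensMl; try typecheck.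
rewrite -[(_ * _) * front y s]acompA; try typecheck.
rewrite -front_front // 1?eq_sym // (delC x y) in tdd *.
rewrite [(aid !y @ _) * _]acompA; try typecheck.
rewrite !atensA atens_id (slide (ty_sym !x !y) tdd).
rewrite acompA; try typecheck.
rewrite [asym !y !x @ _ * _]acompA; try typecheck.
rewrite -atensMr // asymK atens_id acomp1m; last by typecheck.
rewrite atensMl; try typecheck.
by rewrite -acompA ?atensA ?atens_id //; typecheck.
Qed.

(** The coherence theorem in usable form: on distinct wires the lists at both ends determine the
    permutation, so intermediate orders disappear. *)
Lemma shuffleM s t u : uniq s -> perm_eq s t -> perm_eq t u ->
  shuffle t u * shuffle s t = shuffle s u.
Proof.
elim: u s t => [|x u IH] s t us st tu.
  by move/perm_nilP: tu st => -> /perm_nilP -> /=; rewrite acomp1m.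
have ut : uniq t by rewrite -(perm_uniq st).
have [xt udt dtu] := perm_consr ut tu.
have xs : x \in s by rewrite (perm_mem st).
have uds := del_uniq x us; have dst := perm_del x st.
have t1 := ty_shuffle us st; have t2 := ty_front ut xt.
have t3 := ty_shuffle udt dtu; have t4 := ty_shuffle uds dst.
have t5 := ty_front us xs.
rewrite /= -acompA; try typecheck.
rewrite front_shuffle // acompA; try typecheck.
by rewrite -atensMl ?IH //; typecheck.
Qed.

Lemma shuffle_id s : uniq s -> shuffle s s = aid (I s).
Proof.
elim: s => //= x s IH /andP[xs us].
by rewrite front_cons eqxx (del_cons xs) IH // atens_id acomp1m.
Qed.

Lemma shuffle_catl r s t : uniq (r ++ s) -> perm_eq s t ->
  shuffle (r ++ s) (r ++ t) = aid (I r) @ shuffle s t.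
Proof.
move=> + st; elim: r => [|x r IH] /=; first by rewrite atens1m.
move=> /andP[xs us]; rewrite front_cons eqxx (del_cons xs) IH // atensA atens_id acompm1 //.
have us' := uniq_catr us.
by have t1 := ty_shuffle us' st; typecheck.
Qed.

Lemma front_catr x s r : x \in s -> uniq (s ++ r) ->
  front x (s ++ r) = front x s @ aid (I r).
Proof.
elim: s => // y s IH; rewrite inE /= => + /andP[ys us].
rewrite !front_cons; have [e _|yx /= xs] := eqVneq y x.
  by rewrite atens_id -ifold_cat.
have xr := notin_catr us xs.
have us' := uniq_catl us.
have t1 := ty_front us' xs.
rewrite atensMr; try typecheck.
by rewrite del_cat (del_notin xr) IH // -!atensA atens_id ifold_cat.
Qed.

Lemma shuffle_catr s t r : uniq (s ++ r) -> perm_eq s t ->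
  shuffle (s ++ r) (t ++ r) = shuffle s t @ aid (I r).
Proof.
elim: t s => [|x t IH] s us; first by move/perm_nilP => e;
  subst s; rewrite /= shuffle_id // atens1m.
have us' := uniq_catl us.
move=> /(perm_consr us')[xs ud dt] /=.
have xr := notin_catr us xs.
have t1 := ty_front us' xs; have t2 := ty_shuffle ud dt.
rewrite front_catr // atensMr; try typecheck.
rewrite del_cat (del_notin xr) IH ?atensA //.
by have := del_uniq x us; rewrite del_cat (del_notin xr).
Qed.

Lemma asym1o (A : C) : asym unito A = aid A.
Proof.
have := asymK A unito; rewrite tenso1 asymo1 acompm1 //.
by rewrite /= tens1o.
Qed.

(** The second hexagon is the inverse of the first: the right-hand side is a left inverse of
    [asym D (A ⊗ B)], whose inverse is the left-hand side. *)
Lemma asym_hexr (A B D : C) :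
  asym (A ⊗ B)%obj D = (asym A D @ aid B) * (aid A @ asym B D).
Proof.
set Y := RHS; have tY : ty Y (A ⊗ B ⊗ D)%obj (D ⊗ A ⊗ B)%obj by rewrite /Y; typecheck.
have e : Y * asym D (A ⊗ B)%obj = aid (D ⊗ A ⊗ B)%obj.
  rewrite asym_hex /Y acomp4; try typecheck.
  rewrite -atensMl // asymK atens_id acomp1m; last by typecheck.
  by rewrite -atensMr // asymK atens_id.
rewrite -[RHS](acompm1 (A := (A ⊗ B ⊗ D)%obj)) ?(proj1 tY) // -asymK acompA; try typecheck.
by rewrite e acomp1m //= tensA.
Qed.

Lemma front_mid x s t : uniq (s ++ x :: t) ->
  front x (s ++ x :: t) = asym (I s) !x @ aid (I t).
Proof.
elim: s => [|y s IH]; first by rewrite front_cons eqxx asym1o atens_id.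
move=> /andP[ys us]; rewrite front_cons IH //.
have [e|yx] := eqVneq y x; first by rewrite e mem_cat mem_head orbT in ys.
have [xs xt] := uniq_mid us.
rewrite del_cat (del_cons xt) (del_notin xs) /= asym_hexr atensMr; try typecheck.
by rewrite ifold_cat -!atensA atens_id.
Qed.

(** Identifies block exchanges with actual symmetries; this is how a symmetry occurring in a formula
    is absorbed into the wire names. *)
Lemma shuffle_catC s t : uniq (s ++ t) ->
  shuffle (s ++ t) (t ++ s) = asym (I s) (I t).
Proof.
elim: t => [|x t IH].
  by rewrite cats0 => us; rewrite shuffle_id // asymo1.
move=> us; rewrite /= front_mid // asym_hex.
have [xs xt] := uniq_mid us.
have := del_uniq x us; rewrite del_cat (del_cons xt) (del_notin xs) => us'.
by rewrite IH.
Qed.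

End Coherence.

(** * Diagrams *)

(* (generator, input wires, output wires); a diagram is a list of such boxes, to
   be applied one after the other to a list of pairwise distinct wires *)
Notation node := (nat * seq wire * seq wire)%type.
Definition nins (n : node) := n.1.2.
Definition nouts (n : node) := n.2.

Definition minus s u := [seq x <- s | x \notin u].
Arguments minus : simpl never.

Definition step s (n : node) := nouts n ++ minus s (nins n).

Lemma mem_minus x s u : (x \in minus s u) = (x \notin u) && (x \in s).
Proof. exact: mem_filter. Qed.

Lemma minus_catl s r u : {in r, forall x, x \notin u} ->
  minus (s ++ r) u = minus s u ++ r.
Proof. by move=> ru; rewrite /minus filter_cat (all_filterP (introT allP ru)). Qed.

Lemma perm_minus s u : uniq s -> uniq u -> {subset u <= s} ->
  perm_eq s (u ++ minus s u).
Proof.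
move=> us uu su; apply: uniq_perm => // [|x].
  rewrite cat_uniq uu filter_uniq // andbT; apply/hasPn => x.
  by rewrite mem_minus => /andP[].
rewrite mem_cat mem_minus; case: (boolP (x \in u)) => [/su|] //.
Qed.

Lemma perm_swap s t : perm_eq (s ++ t) (t ++ s).
Proof. by rewrite perm_catC. Qed.

Definition arity := (seq nat * seq nat)%type.

Section Programs.
Variable sig : seq arity.
Definition gdom g := (nth ([::], [::]) sig g).1.
Definition gcod g := (nth ([::], [::]) sig g).2.

Definition node_ok s (n : node) :=
  [&& uniq s, uniq (nins n), all (mem s) (nins n),
      [seq x.1 | x <- nins n] == gdom n.1.1 &
      [seq x.1 | x <- nouts n] == gcod n.1.1].

(* That the outputs of a node are fresh is checked by the [uniq] of the next
   state. *)
Fixpoint ok s (p : seq node) t : bool :=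
  if p is n :: p' then node_ok s n && ok (step s n) p' t
  else [&& uniq s, uniq t & perm_eq s t].

Lemma ok_uniq s p t : ok s p t -> uniq s.
Proof. by case: p => [|n p] /=; [case/and3P | case/andP=> /and5P[]]. Qed.

Lemma ok_uniqr s p t : ok s p t -> uniq t.
Proof. by elim: p s => [|n p IH] s /=; [case/and3P | case/andP=> _ /IH]. Qed.

Lemma node_perm s n : node_ok s n -> perm_eq s (nins n ++ minus s (nins n)).
Proof. by case/and5P => us un /allP sn _ _; exact: perm_minus. Qed.

Lemma perm_step s s' n : perm_eq s s' -> perm_eq (step s n) (step s' n).
Proof. by move=> ss; rewrite perm_cat2l perm_filter. Qed.

Lemma ok_perml s s' p t : perm_eq s s' -> ok s p t -> ok s' p t.
Proof.
elim: p s s' => [|n p IH] s s' ss /=.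
  by rewrite -(perm_uniq ss) => /and3P[-> -> /(perm_trans _) -> //]; rewrite perm_sym.
case/andP => /and5P[us un sn nd nc] /(IH _ _ (perm_step n ss)) ->.
rewrite /node_ok -(perm_uniq ss) us un nd nc !andbT /=.
by apply/allP => x /(allP sn); rewrite /= (perm_mem ss).
Qed.

Lemma ok_permr s p t t' : perm_eq t t' -> ok s p t -> ok s p t'.
Proof.
move=> tt'; elim: p s => [|n p IH] s /=; last by case/andP => -> /IH.
by case/and3P => -> ut st; rewrite -(perm_uniq tt') ut (perm_trans st).
Qed.

Lemma ok_cat s p t q u : ok s p t -> ok t q u -> ok s (p ++ q) u.
Proof.
elim: p s => [|n p IH] s /=; last by case/andP => -> /IH st /st.
by case/and3P => _ _; rewrite perm_sym; exact: ok_perml.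
Qed.

Variables (C : strict_symmetric) (ob : nat -> C) (gen : nat -> arr C).
Hypothesis ty_gen : forall g, ty (gen g) (cfold ob (gdom g)) (cfold ob (gcod g)).
Local Open Scope arr_scope.
Local Notation I := (ifold ob).
Local Notation shuffle := (shuffle ob).

Definition fire s (n : node) : arr C :=
  (gen n.1.1 @ aid (I (minus s (nins n)))) * shuffle s (nins n ++ minus s (nins n)).

Fixpoint sem s (p : seq node) t : arr C :=
  if p is n :: p' then sem (step s n) p' t * fire s n else shuffle s t.

Lemma ty_node s n : node_ok s n -> ty (gen n.1.1) (I (nins n)) (I (nouts n)).
Proof. by case/and5P => _ _ _ /eqP e1 /eqP e2; rewrite !ifoldE e1 e2. Qed.

Lemma ty_fire s n : node_ok s n -> ty (fire s n) (I s) (I (step s n)).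
Proof.
move=> nk; have t1 := ty_node nk.
have t2 := ty_shuffle ob (proj1 (andP nk)) (node_perm nk).
rewrite /fire /step; typecheck.
Qed.

Lemma ty_sem s p t : ok s p t -> ty (sem s p t) (I s) (I t).
Proof.
elim: p s => [|n p IH] s /=; first by case/and3P => us _; exact: ty_shuffle.
case/andP => nk /IH t1; have t2 := ty_fire nk; typecheck.
Qed.

(** By [shuffleM], the permutation of the inputs factors as one bringing the inputs of the box to
    the front followed by one of the idle wires alone; the latter slides past the box. *)
Lemma fire_shuffle s s' n : node_ok s n -> node_ok s' n -> uniq (step s n) ->
  perm_eq s s' ->
  fire s' n * shuffle s s' = shuffle (step s n) (step s' n) * fire s n.
Proof.
move=> nk nk' us ss; have t1 := ty_node nk.
have us0 := proj1 (andP nk); have us0' := proj1 (andP nk').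
have mm : perm_eq (minus s (nins n)) (minus s' (nins n)) by apply: perm_filter.
have um : uniq (minus s (nins n)) by apply: filter_uniq.
have t2 := ty_shuffle ob us0' (node_perm nk').
have t3 := ty_shuffle ob us0 ss.
have t4 := ty_shuffle ob um mm.
have t5 := ty_shuffle ob us0 (node_perm nk).
have ui : uniq (nins n ++ minus s (nins n)) by rewrite -(perm_uniq (node_perm nk)).
have pi : perm_eq (nins n ++ minus s (nins n)) (nins n ++ minus s' (nins n)).
  by rewrite perm_cat2l.
rewrite /fire -acompA; try typecheck.
rewrite shuffleM //; last exact: node_perm.
rewrite -(shuffleM ob (t := nins n ++ minus s (nins n))) //; last exact: node_perm.
rewrite shuffle_catl // /step shuffle_catl // [LHS]acompA; try typecheck.
rewrite [RHS]acompA; try typecheck.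
by rewrite (slide t1 t4).
Qed.

Lemma sem_perml s s' p t : ok s p t -> perm_eq s s' ->
  sem s' p t * shuffle s s' = sem s p t.
Proof.
move=> k ss; have k' := ok_perml ss k.
elim: p s s' k k' ss => [|n p IH] s s' /=.
  by move=> /and3P[us _ _] /and3P[us' ut st'] ss; rewrite shuffleM.
move=> /andP[nk k] /andP[nk' k'] ss; have ps := perm_step n ss.
have us := ok_uniq k; have us' := proj1 (andP nk).
have t1 := ty_fire nk'; have t2 := ty_sem k'.
have t3 := ty_shuffle ob us' ss; have t4 := ty_fire nk.
have t5 := ty_shuffle ob us ps.
rewrite -acompA; try typecheck.
rewrite fire_shuffle // acompA; try typecheck.
by rewrite IH.
Qed.

Lemma sem_permr s p t t' : ok s p t -> perm_eq t t' ->
  shuffle t t' * sem s p t = sem s p t'.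
Proof.
move=> + tt'; elim: p s => [|n p IH] s /=.
  by case/and3P => us _ st; rewrite shuffleM.
case/andP => nk k; have t1 := ty_fire nk; have t2 := ty_sem k.
have t3 := ty_shuffle ob (ok_uniqr k) tt'.
by rewrite acompA ?IH //; typecheck.
Qed.

Lemma sem_cat s p t q u : ok s p t -> ok t q u ->
  sem t q u * sem s p t = sem s (p ++ q) u.
Proof.
elim: p s => [|n p IH] s /=.
  case/and3P => us ut st k; rewrite sem_perml //; apply: ok_perml k.
  by rewrite perm_sym.
case/andP => nk k k'; have t1 := ty_fire nk; have t2 := ty_sem k.
have t3 := ty_sem k'.
by rewrite acompA ?IH //; typecheck.
Qed.

(** The second hypothesis keeps the idle wires [r] distinct from all wires present during the run of
    [p]. *)
Lemma sem_framer r s p t : ok s p t -> ok (s ++ r) p (t ++ r) ->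
  sem (s ++ r) p (t ++ r) = sem s p t @ aid (I r).
Proof.
elim: p s => [|n p IH] s /=.
  by case/and3P => us ut st /and3P[us' _ _]; exact: shuffle_catr.
case/andP => nk k /andP[nk' k'].
have us' := proj1 (andP nk').
have rn : {in r, forall x, x \notin nins n}.
  move=> x xr; apply/negP => xn; case/and5P: nk => _ _ /allP/(_ x xn) xs _ _.
  by case/negP: (notin_catr us' xs).
have e : step (s ++ r) n = step s n ++ r by rewrite /step minus_catl // catA.
have t1 := ty_fire nk; have t2 := ty_sem k; have t3 := ty_node nk.
have t4 := ty_shuffle ob (proj1 (andP nk)) (node_perm nk).
rewrite e in k' *; rewrite IH // atensMr; try typecheck.
congr (_ * _); rewrite /fire atensMr; try typecheck.
rewrite (minus_catl _ rn) catA shuffle_catr //; last exact: node_perm.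
by rewrite -atensA atens_id ifold_cat.
Qed.

(** The frame on the right, conjugated by the block symmetry, which is natural and involutive. *)
Lemma sem_framel r s p t : ok s p t -> ok (s ++ r) p (t ++ r) ->
  sem (r ++ s) p (r ++ t) = aid (I r) @ sem s p t.
Proof.
move=> k k'; have t1 := ty_sem k.
have us := ok_uniq k'; have ut := ok_uniqr k'.
have k1 := ok_perml (perm_swap s r) k'.
have us1 := ok_uniq k1.
rewrite -(sem_permr k1 (perm_swap t r)) -(sem_perml k1 (perm_swap r s)).
rewrite sem_framer // !shuffle_catC //.
have := asym_nat (sem s p t) (aid (I r)).
rewrite (proj1 t1) (proj2 t1) /= => e.
rewrite acompA; try typecheck.
rewrite e -acompA; try typecheck.
rewrite asymK acompm1 //; typecheck.
Qed.

Lemma sem_block u v p q p' q' t f :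
  ok u p v -> ok u p' v -> sem u p v = sem u p' v ->
  ok (u ++ f) p (v ++ f) -> ok (u ++ f) p' (v ++ f) ->
  ok (v ++ f) q t -> ok (v ++ f) q' t -> sem (v ++ f) q t = sem (v ++ f) q' t ->
  sem (u ++ f) (p ++ q) t = sem (u ++ f) (p' ++ q') t.
Proof.
move=> k1 k2 e k3 k4 k5 k6 e'.
by rewrite -!(sem_cat (t := v ++ f)) // !sem_framer // e e'.
Qed.

End Programs.

(** * Rewriting of diagrams *)

Implicit Types (n m : node) (p q : seq node).

Notation swaps := (seq (wire * wire)).

(* Renamings are composed of transpositions, so that they are injective. *)
Definition swap1 x y z : wire :=
  if x.1 != y.1 then z else if z == x then y else if z == y then x else z.

Definition rename (l : swaps) z : wire := foldl (fun z c => swap1 c.1 c.2 z) z l.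

Definition rename_node l n : node :=
  (n.1.1, map (rename l) (nins n), map (rename l) (nouts n)).

(** Each new transposition sends the current image of x to y. A later one may disturb earlier images
    or other wires, so the users of [renaming] test the effect they need. *)
Fixpoint renaming_from (l : swaps) s t : swaps :=
  match s, t with
  | x :: s', y :: t' => renaming_from (rcons l (rename l x, y)) s' t'
  | _, _ => l
  end.

Definition renaming s t := renaming_from [::] s t.

Lemma swap1K x y : involutive (swap1 x y).
Proof.
move=> z; rewrite /swap1; case: (x.1 != y.1) => //.
case: (eqVneq z x) => [->|zx]; first by case: (eqVneq y x) => // _; rewrite eqxx.
case: (eqVneq z y) => [->|zy]; first by rewrite eqxx.
by rewrite (negPf zx) (negPf zy).
Qed.

Lemma rename_inj l : injective (rename l).
Proof.
elim: l => [|c l IH] x y //= /IH.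
exact/(inv_inj (swap1K c.1 c.2)).
Qed.

Lemma rename_colour l x : (rename l x).1 = x.1.
Proof.
elim: l x => //= c l IH x; rewrite IH /swap1.
case: eqVneq => //= e; have [->|_] := eqVneq x c.1 => //.
by have [->|_] := eqVneq x c.2.
Qed.

Section FirstSome.
Variables (A B : Type) (f : A -> option B).

Fixpoint first_some (l : seq A) : option B :=
  if l is a :: l' then if f a is Some b then Some b else first_some l' else None.

Lemma first_someP (P : A -> Prop) l b : foldr (fun a => and (P a)) True l ->
  first_some l = Some b -> exists2 a, P a & f a = Some b.
Proof.
elim: l => //= a l IH [pa /IH{}IH]; case E: (f a) => [b'|] // [<-].
by exists a.
Qed.

End FirstSome.

Section Checker.
Variable sig : seq arity.

Lemma rename_minus l s u :
  minus (map (rename l) s) (map (rename l) u) = map (rename l) (minus s u).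
Proof.
rewrite /minus filter_map; congr map; apply: eq_filter => x /=.
by rewrite (mem_map (@rename_inj l)).
Qed.

Lemma rename_step l s n :
  step (map (rename l) s) (rename_node l n) = map (rename l) (step s n).
Proof. by rewrite /step /= rename_minus map_cat. Qed.

Lemma rename_ok l s p t : ok sig s p t ->
  ok sig (map (rename l) s) (map (rename_node l) p) (map (rename l) t).
Proof.
have inj := @rename_inj l.
elim: p s => [|n p IH] s /=; first by rewrite !map_inj_uniq // => /and3P[-> -> /(perm_map _)->].
case/andP => /and5P[us un sn nd nc] /IH k; rewrite rename_step k andbT.
rewrite /node_ok !map_inj_uniq // us un -!map_comp /=.
rewrite !(eq_map (g := fst) (rename_colour l)) nd nc !andbT.
by apply/allP => _ /mapP[x xn ->]; rewrite /= mem_map //; exact: (allP sn).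
Qed.

Inductive expr :=
  | Gen of nat | Id of nat | Sw of nat & nat | One
  | Comp of expr & expr | Tens of expr & expr.

Fixpoint edom e : seq nat :=
  match e with
  | Gen g => gdom sig g
  | Id c => [:: c]
  | Sw c d => [:: c; d]
  | One => [::]
  | Comp _ e' => edom e'
  | Tens e e' => edom e ++ edom e'
  end.

(** Side conditions for running [p] beside the idle inputs of [p'], then [p'] beside the outputs of
    [p]. *)
Definition par_ok s p t s' p' t' :=
  [&& ok sig s p t, ok sig s' p' t', ok sig (s ++ s') p (t ++ s') &
      ok sig (s' ++ t) p' (t' ++ t)].

Fixpoint compile e s k : option (seq node * seq wire * nat) :=
  match e with
  | Gen g => let t := zip (gcod sig g) (iota k (size (gcod sig g))) in
      let p := [:: (g, s, t)] in
      if ok sig s p t then Some (p, t, k + size t) else None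
  | Id c => if [seq x.1 | x <- s] == [:: c] then Some ([::], s, k) else None
  | Sw c d => if s is [:: x; y] then
      if [&& x != y, x.1 == c & y.1 == d] then Some ([::], [:: y; x], k) else None
      else None
  | One => if s is [::] then Some ([::], [::], k) else None
  | Comp e1 e2 =>
      if compile e2 s k is Some (p, t, k1) then
        if compile e1 t k1 is Some (q, u, k2) then Some (p ++ q, u, k2) else None
      else None
  | Tens e1 e2 =>
      let n1 := size (edom e1) in
      if compile e1 (take n1 s) k is Some (p, t, k1) then
        if compile e2 (drop n1 s) k1 is Some (q, u, k2) then
          if par_ok (take n1 s) p t (drop n1 s) q u
          then Some (p ++ q, t ++ u, k2) else None
        else None
      else None
  end.

Definition swap_ok s n m p t :=
  let u := nins n ++ nins m in
  let v := nouts n ++ nouts m in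
  let r := minus s u in
  [&& perm_eq s (u ++ r), par_ok (nins n) [:: n] (nouts n) (nins m) [:: m] (nouts m),
      par_ok (nins m) [:: m] (nouts m) (nins n) [:: n] (nouts n),
      ok sig (u ++ r) [:: n; m] (v ++ r), ok sig (u ++ r) [:: m; n] (v ++ r),
      ok sig (v ++ r) p t, ok sig s [:: n, m & p] t & ok sig s [:: m, n & p] t].

(* Moves [n] to the head of [p], past nodes it commutes with. *)
Fixpoint pull n s p t : option (seq node) :=
  if p is m :: p' then
    if m == n then Some p' else
    if pull n (step s m) p' t is Some q then
      if swap_ok s m n q t then Some (m :: q) else None
    else None
  else None.

(* Equality up to the order of independent nodes and the names of inner wires;
   the search backtracks because nodes without inputs may be confused. *)
Fixpoint alpha s p t q t' : bool :=
  if q is n :: q' then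
    has (fun m =>
      if (m.1.1 == n.1.1) && (nins m == nins n) then
        let l := renaming (nouts m) (nouts n) in
        let t1 := map (rename l) t in
        if map (rename l) s == s then
          if pull n s (map (rename_node l) p) t1 is Some p' then
            alpha (step s n) p' t1 q' t'
          else false
        else false
      else false) p
  else (p == [::]) && (t == t').

Definition fin s p := foldl step s p.

Definition wires s p := s ++ flatten [seq nouts n | n <- p].

Definition fresh s := (foldr maxn 0 (unzip2 s)).+1.

(* [bind], [matches], [bind_all] and [split_after] need no correctness proof:
   [rewrite_at] validates the occurrence of the left-hand side they propose. *)
Fixpoint bind (a : swaps) s t : option swaps :=
  match s, t with
  | [::], [::] => Some a
  | x :: s', y :: t' =>
      if has (fun c => (c.1 == x) || (c.2 == y)) a then
        if (x, y) \in a then bind a s' t' else None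
      else bind ((x, y) :: a) s' t'
  | _, _ => None
  end.

Fixpoint matches l p (a : swaps) : seq swaps :=
  if l is n :: l' then
    flatten [seq if m.1.1 == n.1.1 then
                   if bind a (nins n ++ nouts n) (nins m ++ nouts m) is Some a'
                   then matches l' (rem m p) a' else [::]
                 else [::] | m <- p]
  else [:: a].

Fixpoint bind_all s w (a : swaps) : seq swaps :=
  if s is x :: s' then
    if x \in unzip1 a then bind_all s' w a
    else flatten [seq if (y.1 == x.1) && (y \notin unzip2 a)
                      then bind_all s' w ((x, y) :: a) else [::] | y <- w]
  else [:: a].

Fixpoint split_after (d : seq wire) p : seq node * seq node :=
  if p is n :: p' then
    if has (mem d) (nins n)
    then let c := split_after (nouts n ++ d) p' in (c.1, n :: c.2)
    else let c := split_after d p' in (n :: c.1, c.2)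
  else ([::], [::]).

(** The boxes downstream of the occurrence form [post]. They are rerouted by [ren'] from the old
    outputs [o] to the new [o'], which may be inputs of the occurrence when the right-hand side has
    bare wires. The final [alpha] test certifies that [p] can be reordered as [pre ++ l ++ post]. *)
Definition rewrite_at (er : expr) s p t u0 l0 o0 (a : swaps) :
    option (seq node * seq wire) :=
  let ren := renaming (unzip1 a) (unzip2 a) in
  let u := map (rename ren) u0 in
  let l := map (rename_node ren) l0 in
  let o := map (rename ren) o0 in
  if compile er u (fresh (wires s p)) is Some (l', o', _) then
    let: (pre, post) := split_after o [seq n <- p | n \notin l] in
    let f := minus (fin s pre) u in
    let ren' := renaming o o' in
    let post' := map (rename_node ren') post in
    let t' := map (rename ren') t in
    if [&& map (rename ren') o == o', map (rename ren') f == f,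
        ok sig u l o, ok sig u l' o', ok sig (u ++ f) l (o ++ f),
        ok sig (u ++ f) l' (o' ++ f), ok sig (o ++ f) post t,
        perm_eq (fin s pre) (u ++ f), ok sig s (pre ++ l' ++ post') t' &
        alpha s p t (pre ++ l ++ post) t]
    then Some (pre ++ l' ++ post', t') else None
  else None.

Definition inputs e := zip (edom e) (iota 0 (size (edom e))).

Definition rewrite_once (c : expr * expr) s p t : option (seq node * seq wire) :=
  let u := inputs c.1 in
  if compile c.1 u (size u) is Some (l, o, _) then
    first_some (rewrite_at c.2 s p t u l o)
      (flatten [seq bind_all u (wires s p) a | a <- matches l p [::]])
  else None.

Fixpoint normalize (fuel : nat) (rules : seq (expr * expr)) s p t :=
  if fuel is fuel'.+1 then
    if first_some (fun c => rewrite_once c s p t) rules is Some (p', t')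
    then normalize fuel' rules s p' t' else (p, t)
  else (p, t).

(* The rules are applied from left to right, to both sides. *)
Definition prove (fuel : nat) (rules : seq (expr * expr)) (e e' : expr) :=
  let s := inputs e in
  if compile e s (size s) is Some (p, t, _) then
    if compile e' s (size s) is Some (p', t', _) then
      let: (q, u) := normalize fuel rules s p t in
      let: (q', u') := normalize fuel rules s p' t' in
      alpha s q u q' u'
    else false
  else false.

Variables (C : strict_symmetric) (ob : nat -> C) (gen : nat -> arr C).
Hypothesis ty_gen : forall g,
  ty (gen g) (cfold ob (gdom sig g)) (cfold ob (gcod sig g)).
Local Open Scope arr_scope.
Local Notation I := (ifold ob).
Local Notation shuffle := (shuffle ob).
Local Notation ok := (ok sig).
Local Notation sem := (sem ob gen).

Fixpoint den e : arr C :=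
  match e with
  | Gen g => gen g
  | Id c => aid (ob c)
  | Sw c d => asym (ob c) (ob d)
  | One => aid unito
  | Comp e1 e2 => den e1 * den e2
  | Tens e1 e2 => den e1 @ den e2
  end.

Lemma rename_ifold l s : I (map (rename l) s) = I s.
Proof. by elim: s => //= x s ->; rewrite rename_colour. Qed.

Lemma rename_del l x s :
  del (rename l x) (map (rename l) s) = map (rename l) (del x s).
Proof.
rewrite /del filter_map; congr map; apply: eq_filter => y /=.
by rewrite (inj_eq (@rename_inj l)).
Qed.

Lemma rename_front l x s :
  front ob (rename l x) (map (rename l) s) = front ob x s.
Proof.
elim: s => // y s IH; rewrite map_cons !front_cons (inj_eq (@rename_inj l)).
by rewrite -map_cons rename_ifold rename_del rename_ifold IH !rename_colour.
Qed.

Lemma rename_shuffle l s t : shuffle (map (rename l) s) (map (rename l) t) = shuffle s t.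
Proof.
elim: t s => [|x t IH] s /=; first by rewrite rename_ifold.
by rewrite rename_front rename_del IH rename_colour.
Qed.

Lemma rename_sem l s p t :
  sem (map (rename l) s) (map (rename_node l) p) (map (rename l) t) = sem s p t.
Proof.
elim: p s => [|n p IH] s /=; first exact: rename_shuffle.
rewrite rename_step IH /fire /= rename_minus rename_ifold -map_cat.
by rewrite rename_shuffle.
Qed.

Lemma sem_par s p t s' p' t' : par_ok s p t s' p' t' ->
  ok (s ++ s') (p ++ p') (t ++ t') /\
  sem (s ++ s') (p ++ p') (t ++ t') = sem s p t @ sem s' p' t'.
Proof.
case/and4P => k k' k1 k2.
have k3 : ok (t ++ s') p' (t ++ t').
  by apply: ok_permr (perm_swap _ _) _; apply: ok_perml (perm_swap _ _) _.
split; first exact: ok_cat k1 k3.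
have t1 := ty_sem ty_gen k; have t2 := ty_sem ty_gen k'.
rewrite -(sem_cat ty_gen k1 k3) (sem_framer ty_gen) // (sem_framel ty_gen) //.
rewrite -atensM; try typecheck.
by rewrite acomp1m ?(proj2 t1) // acompm1 // (proj1 t2).
Qed.

(** With [sem_par], this is the interchange law: running independent diagrams in either order yields
    their tensor product. *)
Lemma sem_par_flip s p t s' p' t' : par_ok s' p' t' s p t ->
  ok (s ++ s') (p' ++ p) (t ++ t') /\
  sem (s ++ s') (p' ++ p) (t ++ t') = sem s p t @ sem s' p' t'.
Proof.
case/and4P => k' k k1 k2.
have k3 : ok (s ++ s') p' (s ++ t').
  by apply: ok_permr (perm_swap _ _) _; apply: ok_perml (perm_swap _ _) _.
split; first exact: ok_cat k3 k2.
have t1 := ty_sem ty_gen k; have t2 := ty_sem ty_gen k'.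
rewrite -(sem_cat ty_gen k3 k2) (sem_framer ty_gen) // (sem_framel ty_gen) //.
rewrite -atensM; try typecheck.
by rewrite acomp1m ?(proj2 t2) // acompm1 // (proj1 t1).
Qed.

Lemma minus_self s : minus s s = [::].
Proof.
by apply/eqP; rewrite -[_ == _]negbK -has_filter; apply/negP => /hasP[x xs /negP].
Qed.

Lemma sem_node g s t : ok s [:: (g, s, t)] t -> sem s [:: (g, s, t)] t = gen g.
Proof.
case/andP => nk /and3P[_ ut _]; have t1 := ty_node ty_gen nk.
rewrite /= /fire /step /= minus_self !cats0 atensm1 !shuffle_id //; last first.
  by case/andP: nk.
by rewrite acompm1 ?(proj1 t1) // acomp1m // (proj2 t1).
Qed.

Lemma compile_sound e s k p t k' : compile e s k = Some (p, t, k') ->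
  ok s p t /\ sem s p t = den e.
Proof.
elim: e s k p t k' => [g|c|c d||e1 IH1 e2 IH2|e1 IH1 e2 IH2] s k p t k' /=.
- by case: ifP => // ks [<- <- _]; rewrite sem_node.
- case: ifP => // /eqP; case: s => [|x [|y s]] // [<-] [<- <- _] /=.
  rewrite perm_refl; split=> //.
  by rewrite -/(shuffle [:: x] [:: x]) shuffle_id //= tenso1.
- case: s => [|x [|y []]] //; case: ifP => // /and3P[xy /eqP<- /eqP<-] [<- <- _].
  have us : uniq ([:: x] ++ [:: y]) by rewrite /= inE xy.
  have us' : uniq ([:: y] ++ [:: x]) by rewrite /= inE eq_sym xy.
  split; first by apply/and3P; split=> //; exact: perm_swap [:: x] [:: y].
  (* The empty program from [x; y] to [y; x] denotes a shuffle, which is the symmetry itself. *)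
  by have := shuffle_catC ob us; rewrite /= !tenso1.
- by case: s => // - [<- <- _].
- case E2: (compile e2 s k) => [[[p2 t2] k2]|] //.
  case E1: (compile e1 t2 k2) => [[[p1 t1] k1]|] // [<- <- _].
  have [o2 <-] := IH2 _ _ _ _ _ E2; have [o1 <-] := IH1 _ _ _ _ _ E1.
  by split; [exact: ok_cat o2 o1 | rewrite (sem_cat ty_gen o2 o1)].
case E1: (compile e1 _ k) => [[[p1 t1] k1]|] //.
case E2: (compile e2 _ k1) => [[[p2 t2] k2]|] //.
case: ifP => // pk [<- <- _].
have [o2 <-] := IH2 _ _ _ _ _ E2; have [o1 <-] := IH1 _ _ _ _ _ E1.
by have := sem_par pk; rewrite cat_take_drop.
Qed.

Lemma swap_sound s n m p t : swap_ok s n m p t ->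
  sem s [:: n, m & p] t = sem s [:: m, n & p] t.
Proof.
set u := nins n ++ nins m; set v := nouts n ++ nouts m; set r := minus s u.
case/and5P => su pk pk' k1 /and4P[k2 k k3 k4].
have [o1 e1] := sem_par pk; have [o2 e2] := sem_par_flip pk'.
rewrite -(sem_perml ty_gen k3 su) -(sem_perml ty_gen k4 su); congr (_ * _).
apply: (@sem_block sig C ob gen ty_gen u v [:: n; m] p [:: m; n] p t r) => //.
exact: etrans e1 (esym e2).
Qed.

Lemma pull_sound n s p t q : pull n s p t = Some q -> ok s p t ->
  ok s (n :: q) t /\ sem s p t = sem s (n :: q) t.
Proof.
elim: p s q => //= m p IH s q; case: eqP => [-> [<-] //|_].
case E: pull => [q'|] //; case: ifP => // sk [<-] /andP[nk k].
have [k' e] := IH _ _ E k; rewrite e.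
split; first by case/and5P: sk => _ _ _ _ /and4P[].
exact: swap_sound sk.
Qed.

(** The renaming is injective and fixes the inputs [s], so [rename_sem] preserves the denotation.
    The output list is renamed along, and the two lists have to coincide literally at the end. *)
Lemma alpha_sound s p t q t' : alpha s p t q t' -> ok s p t ->
  ok s q t' /\ sem s p t = sem s q t'.
Proof.
elim: q s p t => [|n q IH] s p t; first by case/andP => /eqP-> /eqP->.
case/hasP => m _; case: ifP => // _; cbv zeta.
set l := renaming _ _; case: ifP => // /eqP es.
case E: pull => [p'|] // a k.
have := rename_ok l k; rewrite es => k1.
have [/andP[nk k2] e] := pull_sound E k1.
have [k3 e'] := IH _ _ _ a k2; split; first by rewrite /= nk.
by rewrite -(rename_sem l s p t) es e /= e'.
Qed.

Lemma sem_pre s pre p p' t t' : sem (fin s pre) p t = sem (fin s pre) p' t' ->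
  sem s (pre ++ p) t = sem s (pre ++ p') t'.
Proof. by move=> e; elim: pre s e => //= n pre IH s /IH ->. Qed.

Lemma ok_pre s pre p t : ok s (pre ++ p) t -> ok (fin s pre) p t.
Proof. by elim: pre s => //= n pre IH s /andP[_ /IH]. Qed.

Lemma rewrite_at_sound el er s p t u l o a k k' p' t' :
  compile el u k = Some (l, o, k') -> den el = den er ->
  rewrite_at er s p t u l o a = Some (p', t') -> ok s p t ->
  ok s p' t' /\ sem s p t = sem s p' t'.
Proof.
move=> El eq; have [kl el'] := compile_sound El; rewrite /rewrite_at.
set ren := renaming (unzip1 a) _.
have := rename_sem ren u l o; rewrite {}el'.
(* How the occurrence was found is forgotten here: only its denotation and the computed tests
   remain. *)
move: (map _ u) (map _ l) (map _ o) => {El kl}u {}l {}o el'.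
case Er: compile => [[[l' o'] k1]|] //.
have [_ er'] := compile_sound Er.
case: split_after => pre post; set f := minus _ _; set ren' := renaming o o'.
case: ifP => // /and5P[/eqP eo /eqP ef kl kr /and5P[klf krf kp pf /andP[kf al]]] [<- <-] ks.
split=> //; have [k2 ->] := alpha_sound al ks; apply: sem_pre.
have k3 := ok_pre k2; have k4 := ok_pre kf.
rewrite -(sem_perml ty_gen k3 pf) -(sem_perml ty_gen k4 pf); congr (_ * _).
(* Renaming turns the continuation of the old outputs into one of the new outputs, with the same
   frame [f]. *)
have kp' := rename_ok ren' kp; rewrite map_cat eo ef in kp'.
rewrite -(sem_cat ty_gen klf kp) -(sem_cat ty_gen krf kp').
rewrite !(sem_framer ty_gen) // el' er' eq; congr (_ * _).
by rewrite -(rename_sem ren') map_cat eo ef.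
Qed.

Lemma rewrite_once_sound c s p t p' t' : den c.1 = den c.2 ->
  rewrite_once c s p t = Some (p', t') -> ok s p t ->
  ok s p' t' /\ sem s p t = sem s p' t'.
Proof.
rewrite /rewrite_once => eq; case El: compile => [[[l o] k]|] // r.
have [|a _] := first_someP (P := fun=> True) _ r; first by elim: flatten.
exact: rewrite_at_sound El eq.
Qed.

Definition valid (rules : seq (expr * expr)) : Prop :=
  foldr (fun c => and (den c.1 = den c.2)) True rules.

Lemma normalize_sound fuel rules s p t : valid rules -> ok s p t ->
  let c := normalize fuel rules s p t in ok s c.1 c.2 /\ sem s p t = sem s c.1 c.2.
Proof.
move=> v; elim: fuel p t => [|fuel IH] p t k //=.
case E: first_some => [[p' t']|] //.
have [c e r] := first_someP v E.
by have [k' ->] := rewrite_once_sound e r k; exact: IH.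
Qed.

Theorem prove_sound fuel rules e e' : valid rules ->
  prove fuel rules e e' -> den e = den e'.
Proof.
move=> v; rewrite /prove; set s := inputs e.
case E: compile => [[[p t] k]|] //; case E': compile => [[[p' t'] k']|] //.
have [o1 <-] := compile_sound E; have [o2 <-] := compile_sound E'.
have := normalize_sound fuel v o1; have := normalize_sound fuel v o2.
case: normalize => q u; case: normalize => q' u' /= [o3 ->] [o4 ->] a.
by case: (alpha_sound a o4).
Qed.

End Checker.

(** * Reification of identities between morphisms *)

Lemma Arr_idm_tens (C : strict_symmetric) (A B : C) :
  Arr (idm (A ⊗ B)) = (aid A @ aid B)%arr.
Proof. by rewrite atens_id. Qed.

Fixpoint well_typed (C : strict_symmetric) (ob : nat -> C) (sig : seq arity)
    (gens : seq (arr C)) : Prop :=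
  match sig, gens with
  | a :: sig', g :: gens' =>
      ty g (cfold ob a.1) (cfold ob a.2) /\ well_typed ob sig' gens'
  | [::], [::] => True
  | _, _ => False
  end.

(** Out of range the defaults agree: the empty arity and the identity of the unit object. Hence
    every number names a well-typed generator. *)
Lemma well_typed_nth (C : strict_symmetric) (ob : nat -> C) sig gens g :
  well_typed ob sig gens ->
  ty (nth (aid unito) gens g) (cfold ob (gdom sig g)) (cfold ob (gcod sig g)).
Proof.
elim: sig gens g => [|a sig IH] [|f gens] g //=; last first.
  by move=> [t /IH wt]; case: g => [|g] //; exact: wt.
by move=> _; rewrite /gdom /gcod !nth_nil.
Qed.

Lemma diagram (C : strict_symmetric) (obs : seq C) (sig : seq arity)
    (gens : seq (arr C)) fuel rules e e' :
  let ob := nth unito obs in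
  let gen := nth (aid unito) gens in
  well_typed ob sig gens -> valid ob gen rules ->
  prove sig fuel rules e e' -> den ob gen e = den ob gen e'.
Proof.
move=> ob gen wt; apply: prove_sound => g; exact: well_typed_nth.
Qed.

(** The dummy matches on [Set] run the unification test during the construction of a term and
    backtrack to the next entry when it fails. *)
Ltac position x l :=
  match l with
  | cons ?y ?l' =>
    match constr:(Set) with
    | _ => let _ := match constr:(Set) with _ => unify x y end in constr:(O)
    | _ => let n := position x l' in constr:(S n)
    end
  end.

Ltac insert x l :=
  match constr:(Set) with
  | _ => let _ := position x l in l
  | _ => constr:(cons x l)
  end.

Ltac insert_objs A obs :=
  lazymatch A with
  | unito => obs
  | tens ?X ?Y => let obs := insert_objs X obs in insert_objs Y obs
  | _ => insert A obs
  end.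

Ltac collect f env :=
  lazymatch env with (?obs, ?gens) =>
    lazymatch f with
    | acomp ?g ?h => let env := collect g env in collect h env
    | atens ?g ?h => let env := collect g env in collect h env
    | aid ?A => let obs := insert_objs A obs in constr:((obs, gens))
    | Arr (idm ?A) => let obs := insert_objs A obs in constr:((obs, gens))
    | asym ?A ?B =>
        let obs := insert_objs (A ⊗ B)%obj obs in constr:((obs, gens))
    | Arr (sym ?A ?B) =>
        let obs := insert_objs (A ⊗ B)%obj obs in constr:((obs, gens))
    | @Arr _ ?A ?B _ =>
        let obs := insert_objs (A ⊗ B)%obj obs in
        let gens := insert f gens in constr:((obs, gens))
    end
  end.

Ltac collect_rules hs env :=
  lazymatch hs with
  | (?hs', ?h) => let env := collect_rules hs' env in collect_rules h env
  | ?h => lazymatch type of h with ?l = ?r =>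
            let env := collect l env in collect r env
          end
  end.

Ltac colours A obs :=
  lazymatch A with
  | unito => constr:(@nil nat)
  | tens ?X ?Y =>
      let a := colours X obs in let b := colours Y obs in
      eval cbv beta iota delta [cat] in (a ++ b)
  | _ => let i := position A obs in constr:(cons i nil)
  end.

Ltac arities gens obs :=
  lazymatch gens with
  | nil => constr:(@nil arity)
  | cons (@Arr _ ?A ?B _) ?gens' =>
      let a := colours A obs in let b := colours B obs in
      let s := arities gens' obs in constr:(cons (a, b) s)
  end.

Ltac reify obs gens f :=
  lazymatch f with
  | acomp ?g ?h =>
      let a := reify obs gens g in let b := reify obs gens h in constr:(Comp a b)
  | atens ?g ?h =>
      let a := reify obs gens g in let b := reify obs gens h in constr:(Tens a b)
  | aid unito => constr:(One)
  | Arr (idm unito) => constr:(One)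
  | aid ?A => let i := position A obs in constr:(Id i)
  | Arr (idm ?A) => let i := position A obs in constr:(Id i)
  | asym ?A ?B =>
      let i := position A obs in let j := position B obs in constr:(Sw i j)
  | Arr (sym ?A ?B) =>
      let i := position A obs in let j := position B obs in constr:(Sw i j)
  | _ => let i := position f gens in constr:(Gen i)
  end.

Ltac reify_rules obs gens hs acc :=
  lazymatch hs with
  | (?hs', ?h) =>
      let acc := reify_rules obs gens h acc in reify_rules obs gens hs' acc
  | ?h =>
      lazymatch type of h with ?l = ?r =>
        let a := reify obs gens l in let b := reify obs gens r in
        constr:(cons (a, b) acc)
      end
  end.

Ltac rules_valid hs acc :=
  lazymatch hs with
  | (?hs', ?h) => rules_valid hs' constr:(conj h acc)
  | ?h => constr:(conj h acc)
  end.

Ltac to_arr := rewrite ?heq_arr ?(Arr_scomp, Arr_retype, Arr_tensh, ArrM, Arr_idm_tens).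

Ltac check_types := repeat first [exact I | split]; obj_eq.

(** [hs] is a tuple of oriented equations, earlier ones taking priority at each rewriting step; 40
    bounds the number of steps on each side. *)
Ltac diag hs :=
  lazymatch goal with |- @eq (arr ?C) ?l ?r =>
    let env := constr:((@nil (obj C), @nil (arr C))) in
    let env := collect l env in
    let env := collect r env in
    let env := collect_rules hs env in
    lazymatch env with (?obs, ?gens) =>
      let sig := arities gens obs in
      let a := reify obs gens l in let b := reify obs gens r in
      let rules := reify_rules obs gens hs constr:(@nil (expr * expr)) in
      let v := rules_valid hs constr:(I) in
      refine (@diagram C obs sig gens 40 rules a b _ v _);
      [ check_types | vm_compute; reflexivity ]
    end
  end.

(** * Identities in a Hopf brace *)

Section Brace.
Variables (C : strict_symmetric) (B : hopf_brace C).
Local Open Scope arr_scope.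
Local Notation H := (aid (hb B)).
Local Notation η1 := (Arr (aunit (hb_alg1 B))).
Local Notation μ1 := (Arr (amul (hb_alg1 B))).
Local Notation λ1 := (Arr (hb_anti1 B)).
Local Notation η2 := (Arr (aunit (hb_alg2 B))).
Local Notation μ2 := (Arr (amul (hb_alg2 B))).
Local Notation ε := (Arr (counit (hb_coalg B))).
Local Notation δ := (Arr (comul (hb_coalg B))).
Local Notation c := (asym (hb B) (hb B)).

Lemma brace_unit1l : μ1 * (η1 @ H) = H.
Proof. by have := alg_unitl (hopf_alg (hb_hopf1 B)); to_arr. Qed.

Lemma brace_unit1r : μ1 * (H @ η1) = H.
Proof. by have := alg_unitr (hopf_alg (hb_hopf1 B)); to_arr. Qed.

Lemma brace_unit2l : μ2 * (η2 @ H) = H.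
Proof. by have := alg_unitl (hopf_alg (hb_hopf2 B)); to_arr. Qed.

Lemma brace_unit2r : μ2 * (H @ η2) = H.
Proof. by have := alg_unitr (hopf_alg (hb_hopf2 B)); to_arr. Qed.

Lemma brace_counitl : (ε @ H) * δ = H.
Proof. by have := coalg_counitl (hopf_coalg (hb_hopf1 B)); to_arr. Qed.

Lemma brace_coassoc : (δ @ H) * δ = (H @ δ) * δ.
Proof. by have := coalg_coassoc (hopf_coalg (hb_hopf1 B)); to_arr. Qed.

Lemma brace_comul_unit1 : δ * η1 = η1 @ η1.
Proof. by have := hopf_comul_unit (hb_hopf1 B); to_arr. Qed.

Lemma brace_comul_unit2 : δ * η2 = η2 @ η2.
Proof. by have := hopf_comul_unit (hb_hopf2 B); to_arr. Qed.

Lemma brace_counit_unit2 : ε * η2 = aid unito.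
Proof. by have := congr1 (@Arr _ _ _) (hopf_counit_unit (hb_hopf2 B)); to_arr. Qed.

Lemma brace_antipode1 : μ1 * (H @ λ1) * δ = η1 * ε.
Proof. by have := congr1 (@Arr _ _ _) (hopf_antipoder (hb_hopf1 B)); to_arr. Qed.

Lemma brace_compat : μ2 * (H @ μ1) =
  μ1 * (μ2 @ (μ1 * (λ1 @ μ2) * (δ @ H))) * (H @ c @ H) * (δ @ H @ H).
Proof. by have := hb_compat B; rewrite /=; to_arr. Qed.

Local Notation Γ' := (Arr (hb_Gamma' B)).

(* The compatibility condition at h = η2, which is group-like, reads
   η2·(ab) = (η2·a) λ1(η2) (η2·b), i.e. ab = a λ1(η2) b. *)
Lemma antipode1_unit2 : λ1 * η2 = η1.
Proof.
(* The case a = b = η1. Listing [brace_compat] first expands this term to λ1(η2); without it the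
   unit laws collapse the term to η1. *)
transitivity (μ2 * (η2 @ (μ1 * (η1 @ η1)))).
  symmetry.
  diag (brace_compat, brace_comul_unit2, brace_unit2l, brace_unit1l,
    brace_unit1r).
diag (brace_unit2l, brace_unit1l).
Qed.

(** η2 is group-like, so λ1(η2) is its inverse for μ1; that inverse being η1, so is η2. *)
Lemma brace_units : η2 = η1.
Proof.
transitivity (μ1 * (η2 @ (λ1 * η2))).
  diag (antipode1_unit2, brace_unit1r).
diag (esym brace_comul_unit2, brace_antipode1, brace_counit_unit2).
Qed.

Lemma brace_unit2l1 : μ2 * (η1 @ H) = H.
Proof. by rewrite -brace_units brace_unit2l. Qed.

Lemma brace_unit2r1 : μ2 * (H @ η1) = H.
Proof. by rewrite -brace_units brace_unit2r. Qed.

Lemma antipode1_unit : λ1 * η1 = η1.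
Proof. by rewrite -{1}brace_units antipode1_unit2. Qed.

Lemma Gamma'E : Γ' = μ1 * (μ2 @ λ1) * (H @ c) * (δ @ H).
Proof. by rewrite /hb_Gamma'; to_arr. Qed.

Lemma Gamma'_unitl : Γ' * (η1 @ H) = H.
Proof.
diag (Gamma'E, brace_comul_unit1, brace_unit2l1, antipode1_unit, brace_unit1r).
Qed.

Lemma Gamma'_unitr : Γ' * (H @ η1) = η1 * ε.
Proof.
diag (Gamma'E, brace_unit2r1, brace_antipode1).
Qed.

Section Act.
Variables (M : C) (phi1 phi2 : hom (hb B ⊗ M) M).
Local Notation M' := (aid M).
Local Notation φ1 := (Arr phi1).
Local Notation φ2 := (Arr phi2).

(** Associativity of φ1 moves λ1(h₂) from Γ_M to the factor μ2(h₁, a), and coassociativity regroups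
    the three copies of h. *)
Lemma compat_Gamma' : φ1 * (H @ φ1) = φ1 * (μ1 @ M') ->
  φ1 * (μ2 @ (φ1 * (λ1 @ φ2) * (δ @ M'))) * (H @ c @ M') * (δ @ H @ M')
  = φ1 * (Γ' @ φ2) * (H @ c @ M') * (δ @ H @ M').
Proof.
move=> A1.
diag (Gamma'E, A1, brace_coassoc).
Qed.

(** In a·(h·(b·(g·m))) the third hypothesis moves h past b; the other two then merge a with h₁·b and
    h₂ with g. *)
Lemma smash_act_assoc : φ1 * (H @ φ1) = φ1 * (μ1 @ M') ->
  φ2 * (H @ φ2) = φ2 * (μ2 @ M') ->
  φ2 * (H @ φ1) = φ1 * (Γ' @ φ2) * (H @ c @ M') * (δ @ H @ M') ->
  φ1 * (H @ φ2) * (H @ H @ (φ1 * (H @ φ2))) =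
  φ1 * (H @ φ2) * (((μ1 @ μ2) * (H @ ((Γ' @ H) * (H @ c) * (δ @ H)) @ H)) @ M').
Proof.
move=> A1 A2 A3.
diag (A1, A2, A3).
Qed.

Lemma smash_act_unit : φ1 * (η1 @ M') = M' -> φ2 * (η2 @ M') = M' ->
  φ1 * (H @ φ2) * (η1 @ η2 @ M') = M'.
Proof. move=> u1 u2; diag (u1, u2). Qed.

Lemma smash_act_restr1 : φ2 * (η2 @ M') = M' ->
  φ1 * (H @ φ2) * (H @ η2 @ M') = φ1.
Proof. move=> u2; diag (u2). Qed.

Lemma smash_act_restr2 : φ1 * (η1 @ M') = M' ->
  φ1 * (H @ φ2) * (η1 @ H @ M') = φ2.
Proof. move=> u1; diag (u1). Qed.

End Act.

Section Hom.
Variables (M N : C) (phi1 phi2 : hom (hb B ⊗ M) M) (psi1 psi2 : hom (hb B ⊗ N) N).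
Variables (phi : hom (hb B ⊗ hb B ⊗ M) M) (psi : hom (hb B ⊗ hb B ⊗ N) N).
Variable (f : hom M N).
Local Notation F := (Arr f).

Lemma smash_act_linear : F * Arr phi1 = Arr psi1 * (H @ F) ->
  F * Arr phi2 = Arr psi2 * (H @ F) ->
  F * (Arr phi1 * (H @ Arr phi2)) = Arr psi1 * (H @ Arr psi2) * (H @ H @ F).
Proof. move=> l1 l2; diag (l1, l2). Qed.

Lemma restr1_linear : F * Arr phi = Arr psi * (H @ H @ F) ->
  F * (Arr phi * (H @ η2 @ aid M)) = Arr psi * (H @ η2 @ aid N) * (H @ F).
Proof. move=> l; diag (l). Qed.

Lemma restr2_linear : F * Arr phi = Arr psi * (H @ H @ F) ->
  F * (Arr phi * (η1 @ H @ aid M)) = Arr psi * (η1 @ H @ aid N) * (H @ F).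
Proof. move=> l; diag (l). Qed.

End Hom.

Lemma smashE : Arr (amul (smash B)) =
  (μ1 @ μ2) * (H @ ((Γ' @ H) * (H @ c) * (δ @ H)) @ H).
Proof. by rewrite /= /smash_twist; to_arr. Qed.

Section SmashAct.
Variables (M : C) (phi : hom (hb B ⊗ hb B ⊗ M) M).
Local Notation M' := (aid M).
Local Notation φ := (Arr phi).
Local Notation ψ1 := (φ * (H @ η2 @ M')).
Local Notation ψ2 := (φ * (η1 @ H @ M')).

Hypothesis φ_unit : φ * (η1 @ η1 @ M') = M'.
Hypothesis φ_assoc : φ * (H @ H @ φ) =
  φ * (((μ1 @ μ2) * (H @ ((Γ' @ H) * (H @ c) * (δ @ H)) @ H)) @ M').

Lemma smash_unit1 : ψ1 * (η1 @ M') = M'.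
Proof. diag (brace_units, φ_unit). Qed.

Lemma smash_unit2 : ψ2 * (η2 @ M') = M'.
Proof. diag (brace_units, φ_unit). Qed.

(** (a # 1)(b # 1) = ab # 1, because 1 acts trivially on b. *)
Lemma smash_assoc1 : ψ1 * (H @ ψ1) = ψ1 * (μ1 @ M').
Proof.
diag (brace_units, φ_assoc, brace_comul_unit1, Gamma'_unitl, brace_unit2l1).
Qed.

(** (1 # h)(1 # g) = 1 # hg, because h·1 = ε(h)1. *)
Lemma smash_assoc2 : ψ2 * (H @ ψ2) = ψ2 * (μ2 @ M').
Proof.
diag (brace_units, φ_assoc, Gamma'_unitr, brace_counitl, brace_unit1r).
Qed.

(** Both sides are the action of (1 # h)(a # 1) = h₁·a # h₂ = (h₁·a # 1)(1 # h₂). *)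
Lemma smash_compat : ψ2 * (H @ ψ1) = ψ1 * (Γ' @ ψ2) * (H @ c @ M') * (δ @ H @ M').
Proof.
diag (brace_units, φ_assoc, brace_comul_unit1, Gamma'_unitl, brace_unit1l,
  brace_unit1r, brace_unit2l1, brace_unit2r1).
Qed.

(** Because (a # 1)(1 # h) = a # h, a module over the smash product is determined by its two
    restrictions. *)
Lemma smash_factor : ψ1 * (H @ ψ2) = φ.
Proof.
diag (brace_units, φ_assoc, brace_comul_unit1, Gamma'_unitl, brace_unit1r,
  brace_unit2l1).
Qed.

End SmashAct.

(** * Transposition of actions of H2 into coactions of its dual *)

Section Duality.
Variables (D : dual (hb B)).
Local Notation D' := (aid (dual_obj D)).
Local Notation a := (Arr (coev D)).
Local Notation b := (Arr (ev D)).
Local Notation Hd := (dual_obj D).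

Lemma dual_snake1 : (H @ b) * (a @ H) = H.
Proof. by have := dual_triangle1 D; to_arr. Qed.

Lemma dual_snake2 : (b @ D') * (D' @ a) = D'.
Proof. by have := dual_triangle2 D; to_arr. Qed.

Lemma dual_mulE : Arr (amul (dual_alg (hb_coalg B) D)) =
  ((b * (D' @ b @ H)) @ D') * (D' @ D' @ (((c * δ) @ D') * a)).
Proof. by rewrite /=; to_arr. Qed.

Lemma dual_counitE : Arr (counit (dual_coalg (hb_alg2 B) D)) = b * (D' @ η2).
Proof. by rewrite /=; to_arr. Qed.

Lemma dual_comulE : Arr (comul (dual_coalg (hb_alg2 B) D)) =
  ((b * (D' @ (μ2 * c))) @ D' @ D') * (D' @ ((H @ a @ D') * a)).
Proof. by rewrite /=; to_arr. Qed.

Lemma coactionE : Arr (hb_coaction D) = (Γ' @ D') * (H @ asym Hd (hb B)) * (a @ H).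
Proof. by rewrite /hb_coaction; to_arr. Qed.

Section Acts.
Variables (M : C) (phi1 phi2 : hom (hb B ⊗ M) M) (rho : hom M (M ⊗ Hd)).
Local Notation M' := (aid M).
Local Notation φ1 := (Arr phi1).
Local Notation φ2 := (Arr phi2).
Local Notation ρ := (Arr rho).

(** Writing the coevaluation as Σ eᵢ ⊗ eⁱ, [coact] is m ↦ Σ eᵢ·m ⊗ eⁱ, and [act] is h ⊗ m ↦ m₀⟨m₁,
    h⟩. *)
Local Notation coact := ((φ2 @ D') * (H @ asym Hd M) * (a @ M')).
Local Notation act := ((M' @ b) * (ρ @ H) * asym (hb B) M).

Lemma act_coact : (M' @ b) * (coact @ H) * asym (hb B) M = φ2.
Proof. diag (dual_snake1). Qed.

Lemma coact_act : (act @ D') * (H @ asym Hd M) * (a @ M') = ρ.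
Proof. diag (dual_snake2). Qed.

Lemma coact_counit : φ2 * (η2 @ M') = M' ->
  (M' @ (b * (D' @ η2))) * coact = M'.
Proof.
move=> A1; diag (dual_snake1, A1).
Qed.

(** Both sides are Σ eⱼ·(eᵢ·m) ⊗ eʲ ⊗ eⁱ. The symmetry in the dual coproduct undoes the order
    reversal of the nested coevaluations. *)
Lemma coact_coassoc : φ2 * (H @ φ2) = φ2 * (μ2 @ M') ->
  (coact @ D') * coact =
  (M' @ (((b * (D' @ (μ2 * c))) @ D' @ D') * (D' @ ((H @ a @ D') * a)))) * coact.
Proof.
move=> A1; diag (dual_snake1, dual_snake2, A1).
Qed.

(** The product of the dual is convolution, (fg)(h) = f(h₁)g(h₂). Pairing the last factor with h
    turns the two sides into h·(a·m) and Γ'(h₁, a)·(h₂·m). *)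
Lemma coact_compat :
  φ2 * (H @ φ1) = φ1 * (Γ' @ φ2) * (H @ c @ M') * (δ @ H @ M') ->
  coact * φ1 =
  (φ1 @ (((b * (D' @ b @ H)) @ D') * (D' @ D' @ (((c * δ) @ D') * a))))
   * (H @ asym Hd M @ D') * (((Γ' @ D') * (H @ asym Hd (hb B)) * (a @ H)) @ coact).
Proof.
move=> A1; diag (dual_snake1, dual_snake2, A1).
Qed.

Lemma act_unit : (M' @ (b * (D' @ η2))) * ρ = M' -> act * (η2 @ M') = M'.
Proof. move=> A1; diag (A1). Qed.

Lemma act_assoc : (ρ @ D') * ρ =
    (M' @ (((b * (D' @ (μ2 * c))) @ D' @ D') * (D' @ ((H @ a @ D') * a)))) * ρ ->
  act * (H @ act) = act * (μ2 @ M').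
Proof.
move=> A1; diag (dual_snake1, dual_snake2, A1).
Qed.

Lemma act_compat : ρ * φ1 =
  (φ1 @ (((b * (D' @ b @ H)) @ D') * (D' @ D' @ (((c * δ) @ D') * a))))
   * (H @ asym Hd M @ D') * (((Γ' @ D') * (H @ asym Hd (hb B)) * (a @ H)) @ ρ) ->
  act * (H @ φ1) = φ1 * (Γ' @ act) * (H @ c @ M') * (δ @ H @ M').
Proof.
move=> A1; diag (dual_snake1, dual_snake2, A1).
Qed.

End Acts.

Section DualHom.
Variables (M N : C) (phi : hom (hb B ⊗ M) M) (psi : hom (hb B ⊗ N) N).
Variables (rho : hom M (M ⊗ Hd)) (sigma : hom N (N ⊗ Hd)) (f : hom M N).
Local Notation F := (Arr f).

Lemma coact_colinear : F * Arr phi = Arr psi * (H @ F) ->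
  (Arr psi @ D') * (H @ asym Hd N) * (a @ aid N) * F =
  (F @ D') * ((Arr phi @ D') * (H @ asym Hd M) * (a @ aid M)).
Proof. move=> l; diag (l). Qed.

Lemma act_linear : Arr sigma * F = (F @ D') * Arr rho ->
  F * ((aid M @ b) * (Arr rho @ H) * asym (hb B) M) =
  (aid N @ b) * (Arr sigma @ H) * asym (hb B) N * (H @ F).
Proof. move=> l; diag (l). Qed.

End DualHom.
End Duality.

End Brace.

(** * The isomorphisms of categories *)

Lemma isomorphic_sym (C D : category) : isomorphic C D -> isomorphic D C.
Proof. by move=> [F [G [FG GF]]]; exists G, F. Qed.

Lemma fmap_heq (C D : category) (F : functor C D) (A B A' B' : C)
    (f : hom A B) (g : hom A' B') : f ≡ g -> fmap F f ≡ fmap F g.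
Proof. by case. Qed.

Lemma heq_trans (C : category) (A B A' B' A'' B'' : C)
    (f : hom A B) (g : hom A' B') (h : hom A'' B'') : f ≡ g -> g ≡ h -> f ≡ h.
Proof. by move=> fg; case. Qed.

Definition compf (C D E : category) (G : functor D E) (F : functor C D) : functor C E.
Proof.
refine (@Functor C E (fun X => G (F X)) (fun X Y f => fmap G (fmap F f)) _ _).
- by move=> X; rewrite !fmap1.
- by move=> X Y Z g f; rewrite !fmapM.
Defined.

Lemma compf_inverse (C D E : category) (F : functor C D) (F' : functor D C)
    (G : functor D E) (G' : functor E D) :
  is_inverse_functor F F' -> is_inverse_functor G G' ->
  is_inverse_functor (compf G F) (compf F' G').
Proof.
move=> [FO FH] [GO GH]; split=> [X|X Y f] /=; first by rewrite GO FO.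
exact: heq_trans (fmap_heq F' (GH _ _ _)) (FH _ _ f).
Qed.

Lemma isomorphic_trans (C D E : category) :
  isomorphic C D -> isomorphic D E -> isomorphic C E.
Proof.
move=> [F [F' [FF' F'F]]] [G [G' [GG' G'G]]].
by exists (compf G F), (compf F' G'); split; exact: compf_inverse.
Qed.

(** Reduces the action on morphisms of an inverse pair of functors to the underlying morphisms, once
    the objects are known to be equal. *)
Lemma struct_heq (C : strict_symmetric) (T : Type) (U : T -> C) P P1 PM
    (X Y X' Y' : T) (f : @struct_hom C T U P X Y) (g : @struct_hom C T U P X' Y') :
  X = X' -> Y = Y' -> proj1_sig f ≡ proj1_sig g ->
  @heq (@structured_category C T U P P1 PM) X Y f X' Y' g.
Proof.
move=> eX eY; subst X' Y' => fg.
have e : f = g by apply/struct_hom_eq/arr_inj/heq_arr.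
by rewrite e; constructor.
Qed.

Section Equivalences.
Variables (C : strict_symmetric).
Local Open Scope arr_scope.

Lemma lmodP (A M : C) (S : alg A) (phi : hom (A ⊗ M) M) : is_lmod S phi <->
  Arr phi * (Arr (aunit S) @ aid M) = aid M /\
  Arr phi * (aid A @ Arr phi) = Arr phi * (Arr (amul S) @ aid M).
Proof.
by split=> [[u a]|[u a]]; [move: u a; to_arr | constructor; to_arr].
Qed.

Lemma rcomodP (L M : C) (T : coalg L) (rho : hom M (M ⊗ L)) : is_rcomod T rho <->
  (aid M @ Arr (counit T)) * Arr rho = aid M /\
  (Arr rho @ aid L) * Arr rho = (aid M @ Arr (comul T)) * Arr rho.
Proof.
by split=> [[u a]|[u a]]; [move: u a; to_arr | constructor; to_arr].
Qed.

Lemma linearP (A M N : C) (phiM : hom (A ⊗ M) M) (phiN : hom (A ⊗ N) N)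
    (f : hom M N) : linear phiM phiN f <->
  Arr f * Arr phiM = Arr phiN * (aid A @ Arr f).
Proof.
split=> [/(congr1 (@Arr _ _ _))|e]; first by to_arr.
by apply: arr_inj; to_arr.
Qed.

Lemma colinearP (A M N : C) (rhoM : hom M (M ⊗ A)) (rhoN : hom N (N ⊗ A))
    (f : hom M N) : colinear rhoM rhoN f <->
  Arr rhoN * Arr f = (Arr f @ aid A) * Arr rhoM.
Proof.
split=> [/(congr1 (@Arr _ _ _))|e]; first by to_arr.
by apply: arr_inj; to_arr.
Qed.

Variable (B : hopf_brace C).
Local Notation H := (hb B).
Local Notation c := (asym H H).
Local Notation η1 := (Arr (aunit (hb_alg1 B))).
Local Notation η2 := (Arr (aunit (hb_alg2 B))).
Local Notation δ := (Arr (comul (hb_coalg B))).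
Local Notation Γ' := (Arr (hb_Gamma' B)).

Lemma hbm_compatP (M : C) (phi1 phi2 : hom (H ⊗ M) M) :
  is_lmod (hb_alg1 B) phi1 ->
  (phi2 ∘ (idm H ⊗ phi1) ≡
   phi1 ∘ (amul (hb_alg2 B) ⊗
             (phi1 ∘ (hb_anti1 B ⊗ phi2) ∘ (comul (hb_coalg B) ⊗ idm M)))
        ∘ (idm H ⊗ sym H H ⊗ idm M) ∘ (comul (hb_coalg B) ⊗ idm H ⊗ idm M)) <->
  Arr phi2 * (aid H @ Arr phi1) =
  Arr phi1 * (Γ' @ Arr phi2) * (aid H @ c @ aid M) * (δ @ aid H @ aid M).
Proof. by move=> /lmodP[_ a]; rewrite -compat_Gamma' //; to_arr; exact: iff_refl. Qed.

Lemma hbm_arr (X : hb_module B) :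
  Arr (hbm_act2 X) * (aid H @ Arr (hbm_act1 X)) =
  Arr (hbm_act1 X) * (Γ' @ Arr (hbm_act2 X)) * (aid H @ c @ aid X)
    * (δ @ aid H @ aid X).
Proof. exact/(hbm_compatP _ (hbm_lmod1 X))/(hbm_compat X). Qed.

Lemma hb_module_eq (M : C) (p1 p2 q1 q2 : hom (H ⊗ M) M) h1 h2 h3 k1 k2 k3 :
  Arr p1 = Arr q1 -> Arr p2 = Arr q2 ->
  @HbModule C B M p1 p2 h1 h2 h3 = @HbModule C B M q1 q2 k1 k2 k3.
Proof.
move=> /arr_inj e1 /arr_inj e2; subst q1 q2.
by rewrite (proof_irrelevance _ k1 h1) (proof_irrelevance _ k2 h2)
  (proof_irrelevance _ k3 h3).
Qed.

Lemma lmodule_eq (A M : C) (S : alg A) (p q : hom (A ⊗ M) M) h k :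
  Arr p = Arr q -> @Lmodule C A S M p h = @Lmodule C A S M q k.
Proof. by move=> /arr_inj e; subst q; rewrite (proof_irrelevance _ k h). Qed.

Lemma doi_hopf_eq (A L M : C) (S : alg A) (SL : alg L) (TL : coalg L)
    (rA : hom A (A ⊗ L)) (p q : hom (A ⊗ M) M) (r s : hom M (M ⊗ L))
    h1 h2 h3 k1 k2 k3 : Arr p = Arr q -> Arr r = Arr s ->
  @DoiHopfModule C A L S SL TL rA M p r h1 h2 h3 =
  @DoiHopfModule C A L S SL TL rA M q s k1 k2 k3.
Proof.
move=> /arr_inj e1 /arr_inj e2; subst q s.
by rewrite (proof_irrelevance _ k1 h1) (proof_irrelevance _ k2 h2)
  (proof_irrelevance _ k3 h3).
Qed.

Definition smash_act (M : C) (phi1 phi2 : hom (H ⊗ M) M) : hom (H ⊗ H ⊗ M) M :=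
  retype (phi1 ∘ (idm H ⊗ phi2)).

Definition restr1 (M : C) (phi : hom (H ⊗ H ⊗ M) M) : hom (H ⊗ M) M :=
  retype (phi ∘ (idm H ⊗ aunit (hb_alg2 B) ⊗ idm M)).

Definition restr2 (M : C) (phi : hom (H ⊗ H ⊗ M) M) : hom (H ⊗ M) M :=
  retype (phi ∘ (aunit (hb_alg1 B) ⊗ idm H ⊗ idm M)).

Lemma smash_actE M phi1 phi2 :
  Arr (@smash_act M phi1 phi2) = Arr phi1 * (aid H @ Arr phi2).
Proof. by rewrite /smash_act; to_arr. Qed.

Lemma restr1E M phi : Arr (@restr1 M phi) = Arr phi * (aid H @ η2 @ aid M).
Proof. by rewrite /restr1; to_arr. Qed.

Lemma restr2E M phi : Arr (@restr2 M phi) = Arr phi * (η1 @ aid H @ aid M).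
Proof. by rewrite /restr2; to_arr. Qed.

Lemma smash_act_lmod (X : hb_module B) :
  is_lmod (smash B) (smash_act (hbm_act1 X) (hbm_act2 X)).
Proof.
have [/lmodP[u1 a1] /lmodP[u2 a2]] := (hbm_lmod1 X, hbm_lmod2 X).
apply/lmodP; rewrite smash_actE smashE; split.
  by rewrite /= Arr_retype Arr_tensh smash_act_unit.
rewrite -atens_id; exact: smash_act_assoc a1 a2 (hbm_arr X).
Qed.

Lemma smash_axioms (Y : lmodule (smash B)) :
  Arr (lmod_act Y) * (η1 @ η1 @ aid Y) = aid Y /\
  Arr (lmod_act Y) * (aid H @ aid H @ Arr (lmod_act Y)) =
  Arr (lmod_act Y) * (Arr (amul (smash B)) @ aid Y).
Proof.
have /lmodP[u a] := lmod_ax Y; split; last by rewrite atens_id.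
by move: u; rewrite /= Arr_retype Arr_tensh brace_units.
Qed.

Lemma restr1_lmod (Y : lmodule (smash B)) : is_lmod (hb_alg1 B) (restr1 (lmod_act Y)).
Proof.
have [u a] := smash_axioms Y; rewrite smashE in a.
by apply/lmodP; rewrite restr1E smash_unit1 // smash_assoc1.
Qed.

Lemma restr2_lmod (Y : lmodule (smash B)) : is_lmod (hb_alg2 B) (restr2 (lmod_act Y)).
Proof.
have [u a] := smash_axioms Y; rewrite smashE in a.
by apply/lmodP; rewrite restr2E smash_unit2 // smash_assoc2.
Qed.

Definition to_smash (X : hb_module B) : lmodule (smash B) :=
  Lmodule (smash_act_lmod X).

(** Kept transparent: the round trips need its carrier and its actions to compute. *)
Definition of_smash (Y : lmodule (smash B)) : hb_module B.
Proof.
refine (@HbModule C B Y _ _ (restr1_lmod Y) (restr2_lmod Y) _).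
apply/hbm_compatP; first exact: restr1_lmod.
have [u a] := smash_axioms Y; rewrite smashE in a.
by rewrite restr1E restr2E smash_compat.
Defined.

Lemma to_smashK X : of_smash (to_smash X) = X.
Proof.
have [/lmodP[u1 _] /lmodP[u2 _]] := (hbm_lmod1 X, hbm_lmod2 X).
case: X u1 u2 => M p1 p2 h1 h2 h3 /= u1 u2; apply: hb_module_eq.
  by rewrite restr1E smash_actE smash_act_restr1.
by rewrite restr2E smash_actE smash_act_restr2.
Qed.

Lemma of_smashK Y : to_smash (of_smash Y) = Y.
Proof.
have [u a] := smash_axioms Y; rewrite smashE in a.
case: Y u a => M p h /= u a; apply: lmodule_eq.
by rewrite smash_actE restr1E restr2E smash_factor.
Qed.

Lemma to_smash_linear (X Y : hb_module B) (f : hom (X : C) Y) :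
  linear (hbm_act1 X) (hbm_act1 Y) f /\ linear (hbm_act2 X) (hbm_act2 Y) f ->
  linear (lmod_act (to_smash X)) (lmod_act (to_smash Y)) f.
Proof.
case=> /linearP l1 /linearP l2; apply/linearP.
by rewrite /= !smash_actE -atens_id; exact: smash_act_linear.
Qed.

Lemma of_smash_linear (X Y : lmodule (smash B)) (f : hom (X : C) Y) :
  linear (lmod_act X) (lmod_act Y) f ->
  linear (hbm_act1 (of_smash X)) (hbm_act1 (of_smash Y)) f /\
  linear (hbm_act2 (of_smash X)) (hbm_act2 (of_smash Y)) f.
Proof.
move/linearP; rewrite -atens_id => l; split; apply/linearP.
  by rewrite /= !restr1E; exact: restr1_linear.
by rewrite /= !restr2E; exact: restr2_linear.
Qed.

Definition to_smash_functor : functor (hbMod B) (lMod (smash B)).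
Proof.
refine (@Functor (hbMod B) (lMod (smash B)) to_smash
  (fun X Y f => exist _ (proj1_sig f) (to_smash_linear (proj2_sig f))) _ _).
- by move=> X; apply: struct_hom_eq.
- by move=> X Y Z g f; apply: struct_hom_eq.
Defined.

Definition of_smash_functor : functor (lMod (smash B)) (hbMod B).
Proof.
refine (@Functor (lMod (smash B)) (hbMod B) of_smash
  (fun X Y f => exist _ (proj1_sig f) (of_smash_linear (proj2_sig f))) _ _).
- by move=> X; apply: struct_hom_eq.
- by move=> X Y Z g f; apply: struct_hom_eq.
Defined.

Lemma hbMod_smash : isomorphic (hbMod B) (lMod (smash B)).
Proof.
exists to_smash_functor, of_smash_functor; split; split=> [X|X Y f].
- exact: to_smashK.
(* The round trip changes the objects only propositionally, but their carriers are convertible and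
   the underlying morphism is [f] itself. *)
- by apply: struct_heq (to_smashK X) (to_smashK Y) _.
- exact: of_smashK.
- by apply: struct_heq (of_smashK X) (of_smashK Y) _.
Qed.

Section DoiHopf.
Variable D : dual H.
Local Notation Hd := (dual_obj D).
Local Notation a := (Arr (coev D)).
Local Notation b := (Arr (ev D)).
Local Notation doi_hopf := (doi_hopf_module (hb_alg1 B)
  (dual_alg (hb_coalg B) D) (dual_coalg (hb_alg2 B) D) (hb_coaction D)).

Definition coact (M : C) (phi : hom (H ⊗ M) M) : hom M (M ⊗ Hd) :=
  retype ((phi ⊗ idm Hd) ∘ (idm H ⊗ sym Hd M) ∘ (coev D ⊗ idm M)).

Definition act (M : C) (rho : hom M (M ⊗ Hd)) : hom (H ⊗ M) M :=
  retype ((idm M ⊗ ev D) ∘ (rho ⊗ idm H) ∘ sym H M).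

Lemma coactE M phi : Arr (@coact M phi) =
  (Arr phi @ aid Hd) * (aid H @ asym Hd M) * (a @ aid M).
Proof. by rewrite /coact; to_arr. Qed.

Lemma actE M rho : Arr (@act M rho) =
  (aid M @ b) * (Arr rho @ aid H) * asym H M.
Proof. by rewrite /act; to_arr. Qed.

Lemma dh_compatP (M : C) (phi : hom (H ⊗ M) M) (rho : hom M (M ⊗ Hd)) :
  (rho ∘ phi = (phi ⊗ amul (dual_alg (hb_coalg B) D)) ∘ (idm H ⊗ sym Hd M ⊗ idm Hd)
    ∘ (hb_coaction D ⊗ rho))%hom <->
  Arr rho * Arr phi = (Arr phi @ Arr (amul (dual_alg (hb_coalg B) D)))
    * (aid H @ asym Hd M @ aid Hd) * (Arr (hb_coaction D) @ Arr rho).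
Proof.
split=> [/(congr1 (@Arr _ _ _))|e]; first by rewrite !(Arr_scomp, Arr_tensh).
by apply: arr_inj; rewrite !(Arr_scomp, Arr_tensh).
Qed.

Lemma coact_rcomod (X : hb_module B) :
  is_rcomod (dual_coalg (hb_alg2 B) D) (coact (hbm_act2 X)).
Proof.
have /lmodP[u2 a2] := hbm_lmod2 X; apply/rcomodP.
rewrite dual_counitE dual_comulE coactE.
by split; [exact: coact_counit | exact: coact_coassoc].
Qed.

Definition to_doi_hopf (X : hb_module B) : doi_hopf.
Proof.
refine (@DoiHopfModule C H Hd _ _ _ _ X _ _ (hbm_lmod1 X) (coact_rcomod X) _).
apply/dh_compatP; rewrite dual_mulE coactionE coactE.
exact: coact_compat (hbm_arr X).
Defined.

Lemma act_lmod (Y : doi_hopf) : is_lmod (hb_alg2 B) (act (dh_coact Y)).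
Proof.
have /rcomodP := dh_rcomod Y; rewrite dual_counitE dual_comulE => -[u a'].
by apply/lmodP; rewrite actE; split; [exact: act_unit | exact: act_assoc].
Qed.

Definition of_doi_hopf (Y : doi_hopf) : hb_module B.
Proof.
refine (@HbModule C B Y _ _ (dh_lmod Y) (act_lmod Y) _).
apply/hbm_compatP; first exact: dh_lmod.
have /dh_compatP := dh_compat Y; rewrite dual_mulE coactionE actE.
exact: act_compat.
Defined.

Lemma to_doi_hopfK X : of_doi_hopf (to_doi_hopf X) = X.
Proof.
case: X => M p1 p2 h1 h2 h3; apply: hb_module_eq => //.
by rewrite actE coactE act_coact.
Qed.

Lemma of_doi_hopfK Y : to_doi_hopf (of_doi_hopf Y) = Y.
Proof.
case: Y => M p r h1 h2 h3; apply: doi_hopf_eq => //.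
by rewrite coactE actE coact_act.
Qed.

Lemma to_doi_hopf_linear (X Y : hb_module B) (f : hom (X : C) Y) :
  linear (hbm_act1 X) (hbm_act1 Y) f /\ linear (hbm_act2 X) (hbm_act2 Y) f ->
  linear (dh_act (to_doi_hopf X)) (dh_act (to_doi_hopf Y)) f /\
  colinear (dh_coact (to_doi_hopf X)) (dh_coact (to_doi_hopf Y)) f.
Proof.
case=> l1 /linearP l2; split=> //; apply/colinearP.
by rewrite /= !coactE; exact: coact_colinear.
Qed.

Lemma of_doi_hopf_linear (X Y : doi_hopf) (f : hom (X : C) Y) :
  linear (dh_act X) (dh_act Y) f /\ colinear (dh_coact X) (dh_coact Y) f ->
  linear (hbm_act1 (of_doi_hopf X)) (hbm_act1 (of_doi_hopf Y)) f /\
  linear (hbm_act2 (of_doi_hopf X)) (hbm_act2 (of_doi_hopf Y)) f.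
Proof.
case=> l1 /colinearP l2; split=> //; apply/linearP.
by rewrite /= !actE; exact: act_linear.
Qed.

Definition to_doi_hopf_functor : functor (hbMod B) (hbDoiHopfMod B D).
Proof.
refine (@Functor (hbMod B) (hbDoiHopfMod B D) to_doi_hopf
  (fun X Y f => exist _ (proj1_sig f) (to_doi_hopf_linear (proj2_sig f))) _ _).
- by move=> X; apply: struct_hom_eq.
- by move=> X Y Z g f; apply: struct_hom_eq.
Defined.

Definition of_doi_hopf_functor : functor (hbDoiHopfMod B D) (hbMod B).
Proof.
refine (@Functor (hbDoiHopfMod B D) (hbMod B) of_doi_hopf
  (fun X Y f => exist _ (proj1_sig f) (of_doi_hopf_linear (proj2_sig f))) _ _).
- by move=> X; apply: struct_hom_eq.
- by move=> X Y Z g f; apply: struct_hom_eq.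
Defined.

Lemma hbMod_doi_hopf : isomorphic (hbMod B) (hbDoiHopfMod B D).
Proof.
exists to_doi_hopf_functor, of_doi_hopf_functor; split; split=> [X|X Y f].
- exact: to_doi_hopfK.
- by apply: struct_heq (to_doi_hopfK X) (to_doi_hopfK Y) _.
- exact: of_doi_hopfK.
- by apply: struct_heq (of_doi_hopfK X) (of_doi_hopfK Y) _.
Qed.

End DoiHopf.
End Equivalences.

Theorem corollary3p12 (C : strict_symmetric) (H : hopf_brace C)
    (D : dual (hb H)) :
  isomorphic (hbMod H) (lMod (smash H)) /\
  isomorphic (lMod (smash H)) (hbDoiHopfMod H D) /\
  isomorphic (hbMod H) (hbDoiHopfMod H D).
Proof.
have hs := hbMod_smash H; have hd := hbMod_doi_hopf D.
(* The middle isomorphism passes through brace modules. *)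
by split; [|split]=> //; exact: isomorphic_trans (isomorphic_sym hs) hd.
Qed.
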